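(* Let $m,N\in\mathbb{N}=\{1,2,3,\dots\}$ and let $f(z)=z+\sum_{n=2}^{\infty}a_nz^n\in\mathcal{S}^*$ (with $a_1=1$), $\Omega=f(\mathbb{D})$. Then $$|f(z^m)|+\sum_{n=N}^{\infty}|a_n||z|^n\le d(0,\partial\Omega)$$ holds for $|z|=r\le r_0$, where $r_0$ is the smallest positive root of the equation $$4r^m-(1-r^m)^2+4r^N\bigl(N(1-r)+r\bigr)\left(\frac{1-r^m}{1-r}\right)^2=0.$$ The radius $r_0$ is sharp.
   Context: $\mathbb{D}=\{z\in\mathbb{C}:|z|<1\}$. $\mathcal{S}^*$ is the class of univalent starlike functions: analytic $f(z)=z+\sum_{n\ge2}a_nz^n$ on $\mathbb{D}$ with $zf'(z)/f(z)\prec(1+z)/(1-z)$, i.e. $\Re(zf'(z)/f(z))>0$ on $\mathbb{D}$. $d(0,\partial\Omega)$ is the Euclidean distance from $0$ to the boundary of $\Omega$. ''Sharp'' means that $r_0$ cannot be replaced by a larger number so that the inequality still holds for all $f\in\mathcal{S}^*$. *)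

(* Defs.v *)
From Stdlib Require Import Reals.
From Coquelicot Require Import Coquelicot.
Open Scope R_scope.

Definition disk (z : C) : Prop := Cmod z < 1.

(* [f z = sum_n a_n z^n] on the whole unit disk; values of [f] outside the
   disk are irrelevant. *)
Definition has_expansion (f : C -> C) (a : nat -> C) : Prop :=
  forall z : C, disk z -> is_pseries a z (f z).

(* On a disk centred at 0, analyticity is convergence of the expansion at 0. *)
Definition analytic_on_disk (f : C -> C) : Prop :=
  exists a : nat -> C, has_expansion f a.

Definition univalent (f : C -> C) : Prop :=
  forall z w : C, disk z -> disk w -> f z = f w -> z = w.

Definition subordinate (g h : C -> C) : Prop :=
  exists w : C -> C,
    analytic_on_disk w /\ w (RtoC 0) = RtoC 0 /\
    (forall z : C, disk z -> disk (w z)) /\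
    (forall z : C, disk z -> g z = h (w z)).

(* [z f'(z) / f(z)], with its removable singularity at 0 filled in
   ([f 0 = 0] and [f' 0 = 1]). [C_derive] is the complex derivative. *)
Definition starlike_quotient (f : C -> C) (z : C) : C :=
  if Ceq_dec z (RtoC 0) then RtoC 1 else (z * C_derive f z / f z)%C.

(* [f] belongs to the class S^* and has Taylor coefficients [a]. *)
Definition starlike (f : C -> C) (a : nat -> C) : Prop :=
  has_expansion f a /\ a 0%nat = RtoC 0 /\ a 1%nat = RtoC 1 /\
  univalent f /\
  subordinate (starlike_quotient f)
    (fun z : C => ((RtoC 1 + z) / (RtoC 1 - z))%C).

Definition image_of_disk (f : C -> C) (w : C) : Prop :=
  exists z : C, disk z /\ w = f z.

Definition boundary (E : C -> Prop) (w : C) : Prop :=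
  forall eps : R, 0 < eps ->
    (exists u : C, E u /\ Cmod (u - w)%C < eps) /\
    (exists v : C, ~ E v /\ Cmod (v - w)%C < eps).

(* Infimum in the extended reals, so that the empty set is at distance
   [p_infty]. *)
Definition distance (w : C) (E : C -> Prop) : Rbar :=
  Glb_Rbar (fun d : R => exists u : C, E u /\ d = Cmod (w - u)%C).

(* The series converges for every [z] in the disk, power series being
   absolutely convergent there, so [Series] is its actual sum. *)
Definition bohr_inequality (m N : nat) (f : C -> C) (a : nat -> C) (z : C) :
  Prop :=
  Rbar_le
    (Finite (Cmod (f (z ^ m)%C)
       + Series (fun k : nat => Cmod (a (N + k)%nat) * Cmod z ^ (N + k))))
    (distance (RtoC 0) (boundary (image_of_disk f))).

Definition bohr_inequality_upto (m N : nat) (rho : R) : Prop :=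
  forall (f : C -> C) (a : nat -> C), starlike f a ->
  forall z : C, disk z -> Cmod z <= rho -> bohr_inequality m N f a z.

(* At [r = 1] the quotient is read as [0 / 0 = 0] and the value is [4]; with
   the quotient extended continuously it would be [4 + 4 m^2]. Neither is 0,
   so [r = 1] is not a root under any reading. *)
Definition radius_equation_lhs (m N : nat) (r : R) : R :=
  4 * r ^ m - (1 - r ^ m) ^ 2
  + 4 * r ^ N * (INR N * (1 - r) + r) * ((1 - r ^ m) / (1 - r)) ^ 2.

Definition smallest_positive_root (F : R -> R) (r : R) : Prop :=
  0 < r /\ F r = 0 /\ (forall s : R, 0 < s -> F s = 0 -> r <= s).

(* Main.v *)
Require Import Defs.
From Stdlib Require Import Reals Lra Lia Psatz Wf_nat Ranalysis5.
From Stdlib Require Import Classical IndefiniteDescription.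
From Coquelicot Require Import Coquelicot.
Open Scope R_scope.

(** Starlikeness says z f' - f = w (z f' + f) with w a Schwarz function. An
    analytic multiplier bounded by 1 contracts the l^2 norm of coefficients
    (Parseval, here over roots of unity instead of the circle); applied to the
    truncations of z f' + f this gives (n-1)^2 |a_n|^2 <= sum_{k<n} 4 k |a_k|^2,
    hence |a_n| <= n by induction (Clunie's method), and it also gives the
    Schwarz lemma |w z| <= |z|. The latter bounds Re (z f' / f) below by
    (1-r)/(1+r), which integrates along rays to |f z| >= r/(1+r)^2. Every v with
    |v| < 1/4 that is close to the image is then a value of f, because |f - v|
    has an interior minimum on a large closed disk and f' does not vanish; so
    the boundary stays at distance at least 1/4. The coefficient bound reduces
    the inequality to G(r) = r^m/(1-r^m)^2 + sum_{n>=N} n r^n <= 1/4, where G is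
    strictly increasing and the left-hand side of the radius equation is
    4 (1-r^m)^2 (G(r) - 1/4). All estimates are equalities for the Koebe
    function z/(1-z)^2 at positive z. *)

(** * Finite sums and power series on the unit disk *)

(** All complex analysis is done on coefficients and finite sums; no contour integral occurs. Roots
    of unity can replace the circle because discrete Parseval is exact as soon as there are at least
    as many nodes as coefficients, and the tail of the series beyond them is a uniformly small
    error. The contraction is stated for a bounded analytic function times a polynomial, because
    such products reduce to shifts and linear combinations of expansions. Truncating is harmless in
    Clunie's method since w vanishes at 0: the coefficients of w Q up to index n only see those of Q
    below n. The weight 4 k is (k+1)^2 - (k-1)^2, the difference between the coefficients of z f' +
    f and z f' - f, and the induction closes because the sum of 4 k^3 over k < n is (n (n-1))^2. The
    constant 1/4 is the limit of r/(1+r)^2 as r tends to 1. For sharpness the matching upper bound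
    comes from -1/4, a boundary point of the Koebe image: the distance there is at most 1/4, so the
    inequality at z = t forces G(t) <= 1/4. *)

Fixpoint csum (u : nat -> C) (n : nat) : C :=
  match n with O => RtoC 0 | S k => (csum u k + u k)%C end.

Fixpoint rsum (u : nat -> R) (n : nat) : R :=
  match n with O => 0 | S k => rsum u k + u k end.

(** [sum_n] includes its upper index, [csum] stops before it and so has an empty sum; hence the
    shift. *)
Lemma csum_sum_n (u : nat -> C) (n : nat) :
  @sum_n C_AbelianMonoid u n = csum u (S n).
Proof.
  induction n as [|n IH].
  - rewrite sum_O. simpl. now rewrite Cplus_0_l.
  - rewrite sum_Sn, IH. reflexivity.
Qed.

Lemma rsum_sum_n (u : nat -> R) (n : nat) : sum_n u n = rsum u (S n).
Proof.
  induction n as [|n IH].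
  - rewrite sum_O. simpl. now rewrite Rplus_0_l.
  - rewrite sum_Sn, IH. reflexivity.
Qed.

Lemma rsum_ext (u v : nat -> R) (n : nat) :
  (forall k, (k < n)%nat -> u k = v k) -> rsum u n = rsum v n.
Proof.
  induction n as [|n IH]; intros H; simpl; auto.
  rewrite IH, H; auto.
Qed.

Lemma rsum_le (u v : nat -> R) (n : nat) :
  (forall k, (k < n)%nat -> u k <= v k) -> rsum u n <= rsum v n.
Proof.
  induction n as [|n IH]; intros H; simpl; [lra|].
  apply Rplus_le_compat; auto.
Qed.

Lemma rsum_const (c : R) (n : nat) : rsum (fun _ => c) n = INR n * c.
Proof.
  induction n as [|n IH]; [simpl; ring|].
  rewrite S_INR; simpl; rewrite IH; ring.
Qed.

Lemma rsum_ge_0 (u : nat -> R) (n : nat) :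
  (forall k, 0 <= u k) -> 0 <= rsum u n.
Proof.
  intros H. induction n as [|n IH]; simpl; [lra|].
  specialize (H n); lra.
Qed.

Lemma rsum_plus (u v : nat -> R) (n : nat) :
  rsum (fun k => u k + v k) n = rsum u n + rsum v n.
Proof. induction n as [|n IH]; simpl; [ring|rewrite IH; ring]. Qed.

Lemma rsum_scal (c : R) (u : nat -> R) (n : nat) :
  rsum (fun k => c * u k) n = c * rsum u n.
Proof. induction n as [|n IH]; simpl; [ring|rewrite IH; ring]. Qed.

Lemma rsum_mono (u : nat -> R) (n p : nat) :
  (forall k, 0 <= u k) -> (n <= p)%nat -> rsum u n <= rsum u p.
Proof.
  intros H Hnp. induction Hnp as [|p _ IH]; [lra|].
  simpl. specialize (H p). lra.
Qed.

Lemma csum_ext (u v : nat -> C) (n : nat) :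
  (forall k, (k < n)%nat -> u k = v k) -> csum u n = csum v n.
Proof.
  induction n as [|n IH]; intros H; simpl; auto.
  rewrite IH, H; auto.
Qed.

Lemma csum_plus (u v : nat -> C) (n : nat) :
  csum (fun k => u k + v k)%C n = (csum u n + csum v n)%C.
Proof. induction n as [|n IH]; simpl; [ring|rewrite IH; ring]. Qed.

Lemma csum_scal (c : C) (u : nat -> C) (n : nat) :
  csum (fun k => c * u k)%C n = (c * csum u n)%C.
Proof. induction n as [|n IH]; simpl; [ring|rewrite IH; ring]. Qed.

Lemma Cmod_csum (u : nat -> C) (n : nat) :
  Cmod (csum u n) <= rsum (fun k => Cmod (u k)) n.
Proof.
  induction n as [|n IH]; simpl; [rewrite Cmod_0; lra|].
  eapply Rle_trans; [apply Cmod_triangle|lra].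
Qed.

Lemma csum_app (u : nat -> C) (n p : nat) :
  csum u (n + p) = (csum u n + csum (fun k => u (n + k)%nat) p)%C.
Proof.
  induction p as [|p IH].
  - rewrite Nat.add_0_r. simpl. ring.
  - rewrite Nat.add_succ_r. simpl. rewrite IH. ring.
Qed.

Lemma Cmod_minus_sym (x y : C) : Cmod (x - y) = Cmod (y - x).
Proof. rewrite <- (Cmod_opp (x - y)). f_equal. ring. Qed.

Lemma Cmod_triangle_minus (x y : C) : Cmod x - Cmod y <= Cmod (x - y).
Proof.
  assert (H := Cmod_triangle (x - y) y).
  replace (x - y + y)%C with x in H by ring. lra.
Qed.

Lemma is_series_C_iff (u : nat -> C) (l : C) :
  @is_series C_AbsRing C_NormedModule u l <->
  (forall eps, 0 < eps -> exists n0, forall n, (n0 <= n)%nat ->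
     Cmod (csum u n - l) < eps).
Proof.
  unfold is_series. split.
  - intros H eps Heps.
    destruct (proj1 (filterlim_locally_ball_norm _ _) H (mkposreal eps Heps))
      as [n0 Hn0].
    exists (S n0). intros [|n] Hn; [lia|].
    assert (Hb := Hn0 n ltac:(lia)).
    unfold ball_norm in Hb. simpl in Hb.
    change (Cmod (minus (@sum_n C_AbelianMonoid u n) l) < eps) in Hb.
    rewrite csum_sum_n in Hb. exact Hb.
  - intros H. apply filterlim_locally_ball_norm. intros [eps Heps].
    destruct (H eps Heps) as [n0 Hn0]. exists n0. intros n Hn.
    unfold ball_norm. simpl.
    change (Cmod (minus (@sum_n C_AbelianMonoid u n) l) < eps).
    rewrite csum_sum_n. apply (Hn0 (S n)). lia.
Qed.

Lemma is_pseries_C_iff (a : nat -> C) (z l : C) :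
  @is_pseries C_AbsRing C_NormedModule a z l <->
  @is_series C_AbsRing C_NormedModule (fun k => a k * z ^ k)%C l.
Proof.
  assert (E : forall n, @scal C_AbsRing C_NormedModule (@pow_n C_AbsRing z n) (a n)
                        = (a n * z ^ n)%C).
  { intros n. change (@pow_n C_AbsRing z n * a n = a n * z ^ n)%C.
    now rewrite Cmult_comm. }
  unfold is_pseries. split; apply is_series_ext; intros n; now rewrite E.
Qed.

Lemma rsum_le_Series (u : nat -> R) (n : nat) :
  (forall k, 0 <= u k) -> ex_series u -> rsum u n <= Series u.
Proof.
  intros Hu He.
  destruct n as [|n].
  (* The zero series is written [0 * 0] so that [Series_scal_l] evaluates it. *)
  - simpl. apply Rle_trans with (Series (fun _ => 0 * 0)).
    + rewrite Series_scal_l. lra.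
    + apply Series_le; auto. intros k. specialize (Hu k). lra.
  - apply Series_correct in He.
    assert (H := is_lim_seq_incr_compare (sum_n u) (Series u) He).
    rewrite <- rsum_sum_n. apply H.
    intros k. rewrite sum_Sn. specialize (Hu (S k)).
    unfold plus; simpl. lra.
Qed.

Lemma Series_split (u : nat -> R) (n : nat) :
  ex_series u -> Series u = rsum u n + Series (fun k => u (n + k)%nat).
Proof.
  intros He. destruct n as [|n]; [change (Series u = 0 + Series u); ring|].
  rewrite (Series_incr_n u (S n)) by (auto; lia).
  simpl Init.Nat.pred. rewrite <- sum_n_Reals, rsum_sum_n. reflexivity.
Qed.

Lemma Series_tail_lim (u : nat -> R) :
  ex_series u -> is_lim_seq (fun n => Series (fun k => u (n + k)%nat)) 0.
Proof.
  intros He.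
  apply is_lim_seq_incr_1.
  apply is_lim_seq_ext with (fun n => Series u - sum_n u n).
  - intros n. rewrite (Series_split u (S n) He), rsum_sum_n. ring.
  - replace (Finite 0) with (Rbar_minus (Series u) (Series u))
      by (simpl; f_equal; ring).
    apply is_lim_seq_minus'; [apply is_lim_seq_const|].
    now apply Series_correct.
Qed.

(* That is, radius of convergence at least 1. *)
Definition temperate (c : nat -> R) : Prop :=
  (forall n, 0 <= c n) /\
  forall r, 0 <= r < 1 -> exists B, forall n, c n * r ^ n <= B.

Lemma geom_sum_bound (q : R) (n : nat) :
  0 <= q < 1 -> rsum (fun k => q ^ k) n <= / (1 - q).
Proof.
  intros Hq.
  assert (E : (1 - q) * rsum (fun k => q ^ k) n = 1 - q ^ n).
  { induction n as [|n IH]; simpl; [ring|]. rewrite Rmult_plus_distr_l, IH. ring. }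
  assert (0 <= q ^ n) by (apply pow_le; lra).
  apply Rmult_le_reg_l with (1 - q); [lra|]. rewrite E, Rinv_r; lra.
Qed.

Lemma pow_le_1 (q : R) (n : nat) : 0 <= q <= 1 -> q ^ n <= 1.
Proof. intros H. rewrite <- (pow1 n). apply pow_incr. lra. Qed.

Lemma pow_antitone (q : R) (n p : nat) :
  0 <= q <= 1 -> (n <= p)%nat -> q ^ p <= q ^ n.
Proof.
  intros Hq Hnp. replace p with (n + (p - n))%nat by lia.
  rewrite pow_add. rewrite <- (Rmult_1_r (q ^ n)) at 2.
  apply Rmult_le_compat_l; [apply pow_le; lra|now apply pow_le_1].
Qed.

(** Each of the n terms q^k with k < n of the geometric sum is at least q^n. *)
Lemma INR_mult_pow_bound (q : R) (n : nat) :
  0 <= q < 1 -> INR n * q ^ n <= / (1 - q).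
Proof.
  intros Hq. eapply Rle_trans; [|apply (geom_sum_bound q n Hq)].
  rewrite <- rsum_const. apply rsum_le. intros k Hk.
  apply pow_antitone; [lra|lia].
Qed.

(** Boundedness at the midpoint s of r and 1 leaves a ratio r / s < 1, whose powers absorb the
    factor n. Applied twice, this pays for the n^2 in the quadratic remainder of a power series. *)
Lemma temperate_INR (c : nat -> R) :
  temperate c -> temperate (fun n => INR n * c n).
Proof.
  intros [H0 H]. split.
  - intros n. apply Rmult_le_pos; [apply pos_INR|auto].
  - intros r Hr. destruct (H ((1 + r) / 2) ltac:(lra)) as [B HB].
    set (s := (1 + r) / 2) in *.
    exists (B * / (1 - r / s)). intros n.
    assert (Hs : 0 < s) by (unfold s; lra).
    assert (Hq : 0 <= r / s < 1).
    { split; [apply Rdiv_le_0_compat; lra|].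
      apply Rmult_lt_reg_r with s; [lra|]. unfold Rdiv.
      rewrite Rmult_assoc, Rinv_l by lra. unfold s; lra. }
    replace (INR n * c n * r ^ n) with ((c n * s ^ n) * (INR n * (r / s) ^ n)).
    + apply Rmult_le_compat; auto.
      * apply Rmult_le_pos; [auto|apply pow_le; lra].
      * apply Rmult_le_pos; [apply pos_INR|apply pow_le; lra].
      * now apply INR_mult_pow_bound.
    + replace (r ^ n) with (s ^ n * (r / s) ^ n); [ring|].
      rewrite <- Rpow_mult_distr. f_equal. field. lra.
Qed.

Lemma temperate_le (c d : nat -> R) :
  (forall n, 0 <= c n <= d n) -> temperate d -> temperate c.
Proof.
  intros H [_ Hd]. split; [intros n; apply H|].
  intros r Hr. destruct (Hd r Hr) as [B HB]. exists B. intros n.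
  eapply Rle_trans; [|apply (HB n)].
  apply Rmult_le_compat_r; [apply pow_le; lra|apply H].
Qed.

Lemma temperate_1 : temperate (fun _ => 1).
Proof.
  split; [intros; lra|]. intros r Hr. exists 1. intros n.
  rewrite Rmult_1_l. apply pow_le_1; lra.
Qed.

Lemma temperate_series (c : nat -> R) (r : R) :
  temperate c -> 0 <= r < 1 -> ex_series (fun n => c n * r ^ n).
Proof.
  intros [H0 H] Hr. destruct (H ((1 + r) / 2) ltac:(lra)) as [B HB].
  set (s := (1 + r) / 2) in *.
  assert (Hs : 0 < s) by (unfold s; lra).
  assert (Hq : 0 <= r / s < 1).
  { split; [apply Rdiv_le_0_compat; lra|].
    apply Rmult_lt_reg_r with s; [lra|]. unfold Rdiv.
    rewrite Rmult_assoc, Rinv_l by lra. unfold s; lra. }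
  apply (ex_series_le (K := R_AbsRing) (V := R_CompleteNormedModule))
    with (fun n => B * (r / s) ^ n).
  - intros n. change (Rabs (c n * r ^ n) <= B * (r / s) ^ n).
    rewrite Rabs_right.
    + replace (r ^ n) with (s ^ n * (r / s) ^ n).
      * rewrite <- Rmult_assoc. apply Rmult_le_compat_r; [apply pow_le; lra|auto].
      * rewrite <- Rpow_mult_distr. f_equal. field. lra.
    + apply Rle_ge, Rmult_le_pos; [auto|apply pow_le; lra].
  - apply (ex_series_scal_l B (fun n => (r / s) ^ n)).
    apply ex_series_geom. rewrite Rabs_right; lra.
Qed.

Lemma expansion_temperate (f : C -> C) (a : nat -> C) :
  has_expansion f a -> temperate (fun n => Cmod (a n)).
Proof.
  intros H. split; [intros; apply Cmod_ge_0|]. intros r Hr.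
  assert (Hz : disk (RtoC r)).
  { unfold disk. rewrite Cmod_R, Rabs_right; lra. }
  assert (Hs := proj1 (is_series_C_iff _ _) (proj1 (is_pseries_C_iff _ _ _) (H _ Hz))).
  destruct (Hs 1 ltac:(lra)) as [n0 Hn0].
  set (u := fun k => (a k * RtoC r ^ k)%C) in *.
  assert (Hu : forall k, Cmod (a k) * r ^ k = Cmod (u k)).
  { intros k. unfold u. rewrite Cmod_mult, Cmod_pow, Cmod_R, Rabs_right by lra.
    reflexivity. }
  (* From n0 on, consecutive partial sums both lie within 1 of the limit, so a term is at most 2;
     the finite sum covers the earlier terms. *)
  exists (2 + rsum (fun k => Cmod (u k)) n0). intros n. rewrite Hu.
  destruct (Compare_dec.le_lt_dec n0 n) as [Hn|Hn].
  - assert (H1 := Hn0 n Hn). assert (H2 := Hn0 (S n) ltac:(lia)).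
    assert (0 <= rsum (fun k => Cmod (u k)) n0)
      by (apply rsum_ge_0; intros; apply Cmod_ge_0).
    assert (H3 := Cmod_triangle (csum u (S n) - f r) (f r - csum u n)).
    replace (csum u (S n) - f r + (f r - csum u n))%C with (u n) in H3
      by (simpl; ring).
    rewrite (Cmod_minus_sym (f r)) in H3. lra.
  - assert (H1 : rsum (fun k => Cmod (u k)) (S n) <= rsum (fun k => Cmod (u k)) n0).
    { apply rsum_mono; [intros; apply Cmod_ge_0|lia]. }
    assert (0 <= rsum (fun k => Cmod (u k)) n)
      by (apply rsum_ge_0; intros; apply Cmod_ge_0).
    simpl in H1. lra.
Qed.

Lemma temperate_ex_pseries (a : nat -> C) (z : C) :
  temperate (fun n => Cmod (a n)) -> disk z ->
  exists l, @is_pseries C_AbsRing C_NormedModule a z l.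
Proof.
  intros Ha Hz.
  assert (He := temperate_series _ (Cmod z) Ha (conj (Cmod_ge_0 z) Hz)).
  destruct (ex_series_le (K := C_AbsRing) (V := C_CompleteNormedModule)
              (fun n => a n * z ^ n)%C (fun n => Cmod (a n) * Cmod z ^ n)) as [l Hl];
    [|exact He|exists l; apply is_pseries_C_iff; exact Hl].
  intros n. change (Cmod (a n * z ^ n) <= Cmod (a n) * Cmod z ^ n).
  rewrite Cmod_mult, Cmod_pow. lra.
Qed.

Lemma Cmod_le_limit (u : nat -> C) (l c : C) (B : R) (n1 : nat) :
  @is_series C_AbsRing C_NormedModule u l ->
  (forall n, (n1 <= n)%nat -> Cmod (csum u n - c) <= B) -> Cmod (l - c) <= B.
Proof.
  intros H HB. apply Rnot_lt_le. intros Hlt.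
  destruct (proj1 (is_series_C_iff _ _) H (Cmod (l - c) - B) ltac:(lra)) as [n0 Hn0].
  assert (H1 := Hn0 (max n0 n1) ltac:(lia)).
  assert (H2 := HB (max n0 n1) ltac:(lia)).
  assert (H3 := Cmod_triangle (l - csum u (max n0 n1)) (csum u (max n0 n1) - c)).
  replace (l - csum u (max n0 n1) + (csum u (max n0 n1) - c))%C with (l - c)%C in H3
    by ring.
  rewrite (Cmod_minus_sym l (csum _ _)) in H3. lra.
Qed.

(** The quantitative form in which convergence is used: n = 0 bounds f by its majorant series, n = 1
    gives f 0, general n gives the order of contact and the truncation error in Parseval. *)
Lemma expansion_tail_bound (f : C -> C) (a : nat -> C) (z : C) (n : nat) :
  has_expansion f a -> disk z ->
  Cmod (f z - csum (fun k => a k * z ^ k)%C n) <=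
  Series (fun k => Cmod (a (n + k)%nat) * Cmod z ^ (n + k)).
Proof.
  intros Hf Hz.
  assert (He := temperate_series _ (Cmod z) (expansion_temperate f a Hf)
                  (conj (Cmod_ge_0 z) Hz)).
  apply (Cmod_le_limit (fun k => a k * z ^ k)%C) with n.
  { apply is_pseries_C_iff, Hf, Hz. }
  intros p Hp. replace p with (n + (p - n))%nat by lia.
  rewrite csum_app.
  match goal with |- Cmod (?x + ?y - ?x) <= _ => replace (x + y - x)%C with y by ring end.
  eapply Rle_trans; [apply Cmod_csum|].
  erewrite rsum_ext.
  2:{ intros k _. rewrite Cmod_mult, Cmod_pow. reflexivity. }
  apply (rsum_le_Series (fun k => Cmod (a (n + k)%nat) * Cmod z ^ (n + k))).
  - intros k. apply Rmult_le_pos; [apply Cmod_ge_0|apply pow_le, Cmod_ge_0].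
  - apply (ex_series_incr_n (fun k => Cmod (a k) * Cmod z ^ k)). exact He.
Qed.

(** * Linear operations on expansions and order of vanishing at 0 *)

Lemma expansion_plus (f g : C -> C) (a b : nat -> C) :
  has_expansion f a -> has_expansion g b ->
  has_expansion (fun z => f z + g z)%C (fun k => a k + b k)%C.
Proof. intros Hf Hg z Hz. apply (is_pseries_plus a b z); auto. Qed.

Lemma expansion_scal (c : C) (f : C -> C) (a : nat -> C) :
  has_expansion f a -> has_expansion (fun z => c * f z)%C (fun k => c * a k)%C.
Proof.
  intros Hf z Hz. apply (is_pseries_scal c a z); auto. apply Cmult_comm.
Qed.

Lemma expansion_minus (f g : C -> C) (a b : nat -> C) :
  has_expansion f a -> has_expansion g b ->
  has_expansion (fun z => f z - g z)%C (fun k => a k - b k)%C.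
Proof. intros Hf Hg z Hz. apply (is_pseries_minus a b z); auto. Qed.

Lemma expansion_shift (f : C -> C) (a : nat -> C) :
  has_expansion f a ->
  has_expansion (fun z => z * f z)%C
    (fun k => match k with O => RtoC 0 | S j => a j end).
Proof.
  intros Hf z Hz.
  apply (is_pseries_ext (PS_incr_1 a)); [intros [|n]; reflexivity|].
  apply (is_pseries_incr_1 a z (f z)); auto.
Qed.

Lemma expansion_ext (f g : C -> C) (a b : nat -> C) :
  (forall z, disk z -> f z = g z) -> (forall n, a n = b n) ->
  has_expansion f a -> has_expansion g b.
Proof.
  intros H1 H2 Hf z Hz. rewrite <- H1 by auto.
  apply (is_pseries_ext a); auto.
Qed.

Lemma expansion_0 (f : C -> C) (a : nat -> C) :
  has_expansion f a -> f (RtoC 0) = a 0%nat.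
Proof.
  intros Hf.
  assert (H0 : disk (RtoC 0)) by (unfold disk; rewrite Cmod_0; lra).
  assert (H := expansion_tail_bound f a _ 1 Hf H0).
  rewrite (Series_ext _ (fun _ => 0 * 0)) in H.
  2:{ intros n. rewrite Cmod_0. simpl. ring. }
  rewrite Series_scal_l, Rmult_0_l in H. simpl in H.
  assert (H1 := Cmod_ge_0 (f (RtoC 0) - (RtoC 0 + a 0%nat * 1))).
  assert (E : (f (RtoC 0) - (RtoC 0 + a 0%nat * 1))%C = RtoC 0) by (apply Cmod_eq_0; lra).
  apply Ceq_minus.
  etransitivity; [|exact E]. ring.
Qed.

Lemma expansion_order_bound (f : C -> C) (a : nat -> C) (n : nat) :
  has_expansion f a -> (forall k, (k < n)%nat -> a k = RtoC 0) ->
  exists K, 0 <= K /\ forall z, Cmod z <= 1 / 2 -> Cmod (f z) <= K * Cmod z ^ n.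
Proof.
  intros Hf Ha.
  assert (He : forall r, 0 <= r < 1 -> ex_series (fun k => Cmod (a (n + k)%nat) * r ^ (n + k))).
  { intros r Hr. apply (ex_series_incr_n (fun k => Cmod (a k) * r ^ k)).
    apply temperate_series; [now apply (expansion_temperate f)|lra]. }
  set (K := Series (fun k => Cmod (a (n + k)%nat) * (1/2) ^ (n + k))).
  assert (HK : 0 <= K).
  { apply (rsum_le_Series (fun k => Cmod (a (n + k)%nat) * (1/2) ^ (n + k)) 0).
    - intros k. apply Rmult_le_pos; [apply Cmod_ge_0|apply pow_le; lra].
    - apply He; lra. }
  (* For |z| <= 1/2, |z|^(n+k) <= |z|^n (1/2)^k; the factor 2^n turns (1/2)^k into the (1/2)^(n+k)
     of [K]. *)
  exists (2 ^ n * K). split; [apply Rmult_le_pos; [apply pow_le; lra|auto]|].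
  intros z Hz. assert (Hz0 := Cmod_ge_0 z).
  assert (H := expansion_tail_bound f a z n Hf ltac:(unfold disk; lra)).
  replace (csum (fun k => a k * z ^ k)%C n) with (RtoC 0) in H.
  - replace (f z - RtoC 0)%C with (f z) in H by ring.
    eapply Rle_trans; [exact H|].
    replace (2 ^ n * K * Cmod z ^ n) with ((2 ^ n * Cmod z ^ n) * K) by ring.
    unfold K. rewrite <- Series_scal_l.
    apply Series_le.
    + intros k. split.
      * apply Rmult_le_pos; [apply Cmod_ge_0|apply pow_le; lra].
      * rewrite !pow_add.
        replace (2 ^ n * Cmod z ^ n * (Cmod (a (n + k)%nat) * ((1 / 2) ^ n * (1 / 2) ^ k)))
          with (Cmod (a (n + k)%nat) * (Cmod z ^ n * (1 / 2) ^ k) * (2 ^ n * (1 / 2) ^ n))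
          by ring.
        rewrite <- Rpow_mult_distr. replace (2 * (1 / 2)) with 1 by lra.
        rewrite pow1, Rmult_1_r.
        apply Rmult_le_compat_l; [apply Cmod_ge_0|].
        apply Rmult_le_compat_l; [apply pow_le; lra|].
        apply pow_incr; lra.
    + apply (ex_series_scal_l (2 ^ n * Cmod z ^ n)
               (fun k => Cmod (a (n + k)%nat) * (1 / 2) ^ (n + k))).
      apply He; lra.
  - clear H. induction n as [|n IH]; [reflexivity|]. simpl.
    rewrite (Ha n) by lia.
    assert (E : csum (fun k => a k * z ^ k)%C n = RtoC 0).
    { clear - Ha. induction n as [|n IH]; [reflexivity|]. simpl.
      rewrite (Ha n) by lia. rewrite IH; [ring|]. intros k Hk. apply Ha. lia. }
    rewrite E. ring.
Qed.

Lemma small_linear_zero (x K : R) :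
  0 <= x -> (forall t, 0 < t <= 1 / 2 -> x <= K * t) -> x = 0.
Proof.
  intros Hx H. destruct (Rle_lt_or_eq_dec _ _ Hx) as [Hlt|]; [|auto].
  exfalso.
  assert (H1 := H (1 / 2) ltac:(lra)).
  assert (HK : 0 < K) by lra.
  (* At this t the hypothesis reads x <= x / 2. *)
  set (t := x / (2 * K)).
  assert (Et : K * t = x / 2) by (unfold t; field; lra).
  assert (Ht : 0 < t <= 1 / 2).
  { split; [unfold t; apply Rdiv_lt_0_compat; lra|]. nra. }
  assert (H2 := H t Ht). lra.
Qed.

Lemma csum_single (u : nat -> C) (n : nat) :
  (forall k, (k < n)%nat -> u k = RtoC 0) -> csum u (S n) = u n.
Proof.
  intros H. simpl.
  replace (csum u n) with (RtoC 0); [ring|].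
  induction n as [|n IH]; [reflexivity|]. simpl.
  rewrite <- IH by (intros; apply H; lia). rewrite H by lia. ring.
Qed.

Lemma expansion_truncate (f : C -> C) (a : nat -> C) (n : nat) :
  has_expansion f a ->
  has_expansion (fun z => f z - csum (fun k => a k * z ^ k)%C n)%C
    (fun k => if Nat.ltb k n then RtoC 0 else a k).
Proof.
  intros Hf z Hz. apply is_pseries_C_iff, is_series_C_iff. intros eps Heps.
  assert (Hs := proj1 (is_series_C_iff _ _) (proj1 (is_pseries_C_iff _ _ _) (Hf _ Hz))).
  destruct (Hs eps Heps) as [n0 Hn0]. exists (max n0 n). intros p Hp.
  specialize (Hn0 p ltac:(lia)).
  replace p with (n + (p - n))%nat in * by lia.
  rewrite csum_app in *.
  rewrite (csum_ext _ (fun k => RtoC 0 * (a k * z ^ k))%C n).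
  2:{ intros k Hk. destruct (Nat.ltb_spec k n); [ring|lia]. }
  rewrite csum_scal.
  rewrite (csum_ext _ (fun k => a (n + k)%nat * z ^ (n + k))%C (p - n)).
  2:{ intros k Hk. destruct (Nat.ltb_spec (n + k) n); [lia|reflexivity]. }
  match goal with |- Cmod ?x < _ => match type of Hn0 with Cmod ?y < _ =>
    replace x with y by ring end end.
  exact Hn0.
Qed.

(** If the coefficients below k vanish, then f t = a_k t^k + O(t^(k+1)), while f t = O(t^n) with n >
    k; dividing by t^k and letting t tend to 0 gives a_k = 0. Applied to a difference of two
    expansions, it identifies their first coefficients. *)
Lemma expansion_contact (f : C -> C) (a : nat -> C) (n : nat) (K : R) :
  has_expansion f a ->
  (forall z, Cmod z <= 1 / 2 -> Cmod (f z) <= K * Cmod z ^ n) ->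
  forall k, (k < n)%nat -> a k = RtoC 0.
Proof.
  intros Hf HK k. induction k as [k IH] using Wf_nat.lt_wf_ind. intros Hk.
  destruct (expansion_order_bound _ _ (S k) (expansion_truncate f a (S k) Hf))
    as [K' [_ HK']].
  { intros j Hj. destruct (Nat.ltb_spec j (S k)); [reflexivity|lia]. }
  apply Cmod_eq_0, (small_linear_zero _ (Rabs K + K')); [apply Cmod_ge_0|].
  intros t Ht.
  assert (Hz : Cmod (RtoC t) = t) by (rewrite Cmod_R, Rabs_right; lra).
  assert (H1 := HK (RtoC t) ltac:(lra)).
  assert (H2 := HK' (RtoC t) ltac:(lra)). simpl in H2.
  change (csum _ k + a k * RtoC t ^ k)%C
    with (csum (fun j => a j * RtoC t ^ j)%C (S k)) in H2.
  rewrite csum_single in H2 by (intros j Hj; rewrite IH by lia; ring).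
  assert (H3 := Cmod_triangle_minus (a k * RtoC t ^ k) (f (RtoC t))).
  rewrite (Cmod_minus_sym (a k * RtoC t ^ k)) in H3.
  rewrite Cmod_mult, Cmod_pow in H3. rewrite Hz in *.
  assert (Hp : 0 < t ^ k) by (apply pow_lt; lra).
  assert (H4 : K * t ^ n <= Rabs K * (t * t ^ k)).
  { apply Rle_trans with (Rabs K * t ^ n).
    - apply Rmult_le_compat_r; [apply pow_le; lra|apply Rle_abs].
    - apply Rmult_le_compat_l; [apply Rabs_pos|].
      apply (pow_antitone t (S k) n); [lra|lia]. }
  apply Rmult_le_reg_r with (t ^ k); [auto|]. lra.
Qed.

(** * Discrete Parseval identity, Schwarz lemma and Clunie inequality *)

Lemma de_Moivre (t : R) (n : nat) :
  (((cos t, sin t) : C) ^ n)%C = (cos (INR n * t), sin (INR n * t)).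
Proof.
  induction n as [|n IH].
  - simpl. rewrite Rmult_0_l, cos_0, sin_0. reflexivity.
  - rewrite Cpow_S, IH, S_INR.
    replace ((INR n + 1) * t) with (t + INR n * t) by ring.
    rewrite cos_plus, sin_plus. unfold Cmult; simpl. f_equal; ring.
Qed.

Lemma primitive_root_of_unity (M : nat) :
  (0 < M)%nat ->
  exists w : C, Cmod w = 1 /\ (w ^ M)%C = RtoC 1 /\
    forall d, (0 < d < M)%nat -> (w ^ d)%C <> RtoC 1.
Proof.
  intros HM. assert (HM' : 0 < INR M) by (apply lt_0_INR; lia).
  assert (Hpi := PI_RGT_0).
  exists (cos (2 * PI / INR M), sin (2 * PI / INR M)). repeat split.
  - unfold Cmod. simpl. rewrite !Rmult_1_r.
    rewrite <- sqrt_1. f_equal.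
    assert (H := sin2_cos2 (2 * PI / INR M)). unfold Rsqr in H. lra.
  - rewrite de_Moivre. replace (INR M * (2 * PI / INR M)) with (2 * PI) by (field; lra).
    rewrite cos_2PI, sin_2PI. reflexivity.
  - intros d [Hd0 Hd] E. rewrite de_Moivre in E.
    apply (f_equal fst) in E. simpl in E.
    (* Half the angle: cos (2 x) = 1 - 2 (sin x)^2 = 1 would force sin x = 0, but 0 < x < pi. *)
    set (x := INR d * PI / INR M).
    replace (INR d * (2 * PI / INR M)) with (2 * x) in E by (unfold x; field; lra).
    rewrite cos_2a_sin in E.
    assert (0 < INR d) by (apply lt_0_INR; lia).
    assert (INR d < INR M) by (apply lt_INR; lia).
    assert (Hs : 0 < sin x).
    { apply sin_gt_0; unfold x.
      - apply Rdiv_lt_0_compat; [apply Rmult_lt_0_compat|]; lra.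
      - apply Rmult_lt_reg_r with (INR M); [lra|]. unfold Rdiv.
        rewrite Rmult_assoc, Rinv_l by lra. nra. }
    nra.
Qed.

Lemma geom_sum_root_of_unity (q : C) (M : nat) :
  (q ^ M)%C = RtoC 1 -> q <> RtoC 1 -> csum (fun j => q ^ j)%C M = RtoC 0.
Proof.
  intros HM Hq.
  assert (E : ((q - 1) * csum (fun j => q ^ j)%C M = q ^ M - 1)%C).
  { clear. induction M as [|M IH]; simpl; [ring|].
    rewrite Cmult_plus_distr_l, IH. ring. }
  rewrite HM in E.
  assert (Hq' : (q - 1)%C <> RtoC 0) by now apply Cminus_eq_contra.
  replace (csum (fun j => q ^ j)%C M)
    with (/ (q - 1) * ((q - 1) * csum (fun j => q ^ j)%C M))%C
    by (rewrite Cmult_assoc, Cinv_l by auto; ring).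
  rewrite E. ring.
Qed.

Lemma Re_csum (u : nat -> C) (n : nat) : Re (csum u n) = rsum (fun k => Re (u k)) n.
Proof.
  induction n as [|n IH]; [reflexivity|].
  change (Re (csum u n + u n) = rsum (fun k => Re (u k)) n + Re (u n)).
  now rewrite re_plus, IH.
Qed.

Lemma Cmod2_plus (x y : C) :
  Cmod (x + y) ^ 2 = Cmod x ^ 2 + Cmod y ^ 2 + 2 * Re (x * Cconj y).
Proof.
  rewrite !Cmod2_alt. destruct x as [x1 x2], y as [y1 y2]. simpl. ring.
Qed.

Lemma Cmod_conj_inv (w : C) : Cmod w = 1 -> (w * Cconj w)%C = RtoC 1.
Proof.
  intros H. rewrite <- Cmod2_conj, H. f_equal. ring.
Qed.

(** A cross term of degrees i < n is a geometric sum of ratio w^i conj(w)^n = w^(i-n), which is not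
    1 because 0 < n - i < M. The number k of terms is kept apart from the degree n to allow
    induction on k. *)
Lemma roots_orthogonal (M : nat) (w : C) (r : R) (e : nat -> C) (b : C) (n k : nat) :
  Cmod w = 1 -> (w ^ M)%C = RtoC 1 ->
  (forall d, (0 < d < M)%nat -> (w ^ d)%C <> RtoC 1) ->
  (n < M)%nat -> (k <= n)%nat ->
  csum (fun j => csum (fun i => e i * (RtoC r * w ^ j) ^ i)%C k
                 * Cconj (b * (RtoC r * w ^ j) ^ n))%C M = RtoC 0.
Proof.
  intros Hw HM Hd Hn. assert (Hc := Cmod_conj_inv w Hw).
  induction k as [|k IH]; intros Hk.
  - erewrite csum_ext.
    2:{ intros j _. simpl. replace (RtoC 0 * _)%C with (RtoC 0 * RtoC 0)%C by ring.
        reflexivity. }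
    rewrite csum_scal. ring.
  - erewrite csum_ext.
    2:{ intros j _. simpl csum. rewrite Cmult_plus_distr_r. reflexivity. }
    rewrite csum_plus, IH by lia.
    set (q := (w ^ k * Cconj w ^ n)%C).
    rewrite (csum_ext _ (fun j => (e k * Cconj b * RtoC r ^ k * Cconj (RtoC r) ^ n) * q ^ j)%C).
    + assert (Hwk : forall i, (w ^ i * Cconj w ^ i)%C = RtoC 1).
      { intros i. rewrite <- Cpow_mult_l, Hc. apply Cpow_1_l. }
      rewrite csum_scal, geom_sum_root_of_unity; [ring| |].
      * unfold q. rewrite Cpow_mult_l, <- !Cpow_mult_r, !(Nat.mul_comm _ M), !Cpow_mult_r.
        rewrite <- Cpow_conj, HM, !Cpow_1_l.
        replace (Cconj (RtoC 1)) with (RtoC 1) by (unfold Cconj; simpl; now rewrite Ropp_0).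
        rewrite Cpow_1_l. ring.
      * intros Hq. apply (Hd (n - k)%nat); [lia|].
        replace (w ^ (n - k))%C with (w ^ (n - k) * (w ^ k * Cconj w ^ k))%C
          by (rewrite Hwk; ring).
        rewrite Cmult_assoc, <- Cpow_add_r. replace (n - k + k)%nat with n by lia.
        transitivity (w ^ n * Cconj w ^ k * q)%C; [rewrite Hq; ring|].
        transitivity (w ^ n * Cconj w ^ n * (w ^ k * Cconj w ^ k))%C; [unfold q; ring|].
        rewrite !Hwk. ring.
    + intros j _. unfold q.
      rewrite Cmult_conj, Cpow_conj, Cmult_conj, Cpow_conj, !Cpow_mult_l,
        <- !Cpow_mult_r, (Nat.mul_comm k j), (Nat.mul_comm n j). ring.
Qed.

(** Monomials are added one at a time; each new one is orthogonal to the preceding polynomial on the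
    M nodes, so the squares simply add. *)
Lemma discrete_Parseval (M : nat) (w : C) (r : R) (e : nat -> C) (n : nat) :
  Cmod w = 1 -> (w ^ M)%C = RtoC 1 ->
  (forall d, (0 < d < M)%nat -> (w ^ d)%C <> RtoC 1) ->
  (n <= M)%nat ->
  rsum (fun j => Cmod (csum (fun k => e k * (RtoC r * w ^ j) ^ k)%C n) ^ 2) M
  = INR M * rsum (fun k => Cmod (e k) ^ 2 * r ^ (2 * k)) n.
Proof.
  intros Hw HM Hd. induction n as [|n IH]; intros Hn.
  - rewrite (rsum_ext _ (fun _ => 0)); [rewrite rsum_const; simpl; ring|].
    intros k _. simpl. rewrite Cmod_0. ring.
  - erewrite rsum_ext.
    2:{ intros j _. simpl csum. rewrite Cmod2_plus. reflexivity. }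
    rewrite !rsum_plus, IH by lia.
    rewrite rsum_scal, <- Re_csum, roots_orthogonal by (auto; lia).
    rewrite (rsum_ext (fun j => Cmod (e n * (RtoC r * w ^ j) ^ n) ^ 2)
               (fun _ => Cmod (e n) ^ 2 * r ^ (2 * n))).
    + rewrite rsum_const. cbn [rsum]. change (Re (RtoC 0)) with 0. ring.
    + intros j _. rewrite Cmod_mult, Cmod_pow, Cmod_mult, Cmod_pow, Hw, pow1, Rmult_1_r.
      rewrite Rpow_mult_distr. f_equal.
      rewrite Cmod_R, <- pow_mult, Nat.mul_comm, !pow_mult.
      f_equal. apply pow2_abs.
Qed.

Lemma Bernoulli_le (x : R) (n : nat) : 0 <= x <= 1 -> 1 - INR n * x <= (1 - x) ^ n.
Proof.
  intros Hx. induction n as [|n IH]; [simpl; lra|].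
  rewrite S_INR. simpl.
  assert (0 <= INR n) by apply pos_INR.
  assert ((1 - x) * (1 - INR n * x) <= (1 - x) * (1 - x) ^ n)
    by (apply Rmult_le_compat_l; lra).
  nra.
Qed.

Lemma le_of_small_error (x y K : R) :
  0 <= K -> (forall t, 0 < t <= 1 / 2 -> x <= y + K * t) -> x <= y.
Proof.
  intros HK H. apply Rnot_lt_le. intros Hlt.
  assert (0 < 2 * (K + 1)) by lra.
  set (t := Rmin (1 / 2) ((x - y) / (2 * (K + 1)))).
  assert (Ht : 0 < t).
  { unfold t. apply Rmin_glb_lt; [lra|]. apply Rdiv_lt_0_compat; lra. }
  assert (Ht2 : t <= (x - y) / (2 * (K + 1))) by apply Rmin_r.
  assert (H1 := H t (conj Ht (Rmin_l _ _))).
  assert (H2 : (K + 1) * t <= (K + 1) * ((x - y) / (2 * (K + 1))))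
    by (apply Rmult_le_compat_l; lra).
  replace ((K + 1) * ((x - y) / (2 * (K + 1)))) with ((x - y) / 2) in H2 by (field; lra).
  nra.
Qed.

(** On the circle of radius r, |F| is pointwise at most the modulus of the polynomial. Averaging the
    squares over M nodes and using Parseval on both sides gives the claim up to the tail of F beyond
    M. *)
Lemma multiplier_contraction_radius (w F : C -> C) (e g : nat -> C) (K n : nat) (r : R) :
  (forall z, disk z -> Cmod (w z) <= 1) ->
  has_expansion F e ->
  (forall z, disk z -> F z = (w z * csum (fun k => g k * z ^ k) K)%C) ->
  0 <= r < 1 ->
  rsum (fun k => Cmod (e k) ^ 2 * r ^ (2 * k)) n <= rsum (fun k => Cmod (g k) ^ 2) K.
Proof.
  intros Hw HF E Hr.
  set (T := rsum (fun k => Cmod (g k) ^ 2) K).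
  set (B := rsum (fun k => Cmod (g k)) K).
  assert (HB : 0 <= B) by (apply rsum_ge_0; intros; apply Cmod_ge_0).
  (* If the tail is below t and y <= B is the modulus of the polynomial, then (y + t)^2 <= y^2 + (2
     B + 1) t, as t <= 1. *)
  apply (le_of_small_error _ _ (2 * B + 1)); [lra|]. intros t Ht.
  assert (Htail := Series_tail_lim _ (temperate_series _ r (expansion_temperate _ _ HF) Hr)).
  apply is_lim_seq_spec in Htail.
  destruct (Htail (mkposreal t (proj1 Ht))) as [n0 Hn0]. clear Htail. simpl in Hn0.
  (* Beyond [n0] the tail is small; beyond [n] all wanted coefficients of F are counted; beyond [K]
     Parseval is exact for the polynomial. *)
  set (M := S (max n0 (max n K))).
  assert (HM : 0 < INR M) by (apply lt_0_INR; unfold M; lia).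
  destruct (primitive_root_of_unity M ltac:(unfold M; lia)) as [v [Hv [HvM Hvd]]].
  specialize (Hn0 M ltac:(unfold M; lia)). rewrite Rminus_0_r in Hn0.
  apply Rabs_def2 in Hn0. destruct Hn0 as [Htau _].
  apply Rmult_le_reg_l with (INR M); [auto|].
  apply Rle_trans with (INR M * rsum (fun k => Cmod (e k) ^ 2 * r ^ (2 * k)) M).
  { apply Rmult_le_compat_l; [lra|]. apply rsum_mono; [|unfold M; lia].
    intros k. apply Rmult_le_pos; [apply pow2_ge_0|apply pow_le; lra]. }
  rewrite <- (discrete_Parseval M v r e M) by auto.
  apply Rle_trans with
    (rsum (fun j => Cmod (csum (fun k => g k * (RtoC r * v ^ j) ^ k)%C K) ^ 2
                    + (2 * B + 1) * t) M).
  { apply rsum_le. intros j _. set (z := (RtoC r * v ^ j)%C).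
    assert (Hz : Cmod z = r).
    { unfold z. rewrite Cmod_mult, Cmod_pow, Hv, pow1, Cmod_R, Rabs_right; lra. }
    assert (Hd : disk z) by (unfold disk; lra).
    assert (H1 := expansion_tail_bound F e z M HF Hd). rewrite Hz in H1.
    rewrite Cmod_minus_sym in H1.
    assert (H2 := Cmod_triangle_minus (csum (fun k => e k * z ^ k)%C M) (F z)).
    set (x := Cmod (csum (fun k => e k * z ^ k)%C M)) in *.
    set (y := Cmod (csum (fun k => g k * z ^ k)%C K)).
    assert (Hy0 : 0 <= y) by apply Cmod_ge_0.
    assert (Hx0 : 0 <= x) by apply Cmod_ge_0.
    assert (HyB : y <= B).
    { unfold y, B. eapply Rle_trans; [apply Cmod_csum|]. apply rsum_le.
      intros k _. rewrite Cmod_mult, Cmod_pow, Hz.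
      rewrite <- (Rmult_1_r (Cmod (g k))) at 2.
      apply Rmult_le_compat_l; [apply Cmod_ge_0|apply pow_le_1; lra]. }
    assert (HFy : Cmod (F z) <= y).
    { rewrite E by auto. rewrite Cmod_mult. fold y.
      specialize (Hw z Hd). assert (H0 := Cmod_ge_0 (w z)). nra. }
    assert (Hxy : x <= y + t) by lra.
    assert (x ^ 2 <= (y + t) ^ 2) by (apply pow_incr; lra).
    nra. }
  rewrite rsum_plus, rsum_const, (discrete_Parseval M v r g K) by (auto; unfold M; lia).
  rewrite Rmult_plus_distr_l. apply Rplus_le_compat_r.
  apply Rmult_le_compat_l; [lra|]. apply rsum_le. intros k _.
  rewrite <- (Rmult_1_r (Cmod (g k) ^ 2)) at 2.
  apply Rmult_le_compat_l; [apply pow2_ge_0|apply pow_le_1; lra].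
Qed.

(** The radius 1 - t tends to 1: since only n coefficients are summed, the weights (1-t)^(2k) are
    all at least 1 - 2 n t. *)
Lemma multiplier_contraction (w F : C -> C) (e g : nat -> C) (K n : nat) :
  (forall z, disk z -> Cmod (w z) <= 1) ->
  has_expansion F e ->
  (forall z, disk z -> F z = (w z * csum (fun k => g k * z ^ k) K)%C) ->
  rsum (fun k => Cmod (e k) ^ 2) n <= rsum (fun k => Cmod (g k) ^ 2) K.
Proof.
  intros Hw HF E.
  set (S := rsum (fun k => Cmod (e k) ^ 2) n).
  assert (HS : 0 <= S) by (apply rsum_ge_0; intros; apply pow2_ge_0).
  assert (H2n : 0 <= INR (2 * n)) by apply pos_INR.
  apply (le_of_small_error _ _ (INR (2 * n) * S)).
  { apply Rmult_le_pos; auto. }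
  intros t Ht.
  assert (H := multiplier_contraction_radius w F e g K n (1 - t) Hw HF E ltac:(lra)).
  assert (H1 : (1 - INR (2 * n) * t) * S
               <= rsum (fun k => Cmod (e k) ^ 2 * (1 - t) ^ (2 * k)) n).
  { unfold S. rewrite <- rsum_scal. apply rsum_le. intros k Hk.
    rewrite Rmult_comm. apply Rmult_le_compat_l; [apply pow2_ge_0|].
    eapply Rle_trans; [apply Bernoulli_le; lra|].
    apply pow_antitone; [lra|lia]. }
  lra.
Qed.

(** Multiplication by z is a shift of coefficients, so a polynomial factor is handled by linear
    combinations of shifts, without a Cauchy product. *)
Lemma analytic_mult_poly (w : C -> C) (g : nat -> C) (K : nat) :
  analytic_on_disk w ->
  analytic_on_disk (fun z => w z * csum (fun k => g k * z ^ k) K)%C.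
Proof.
  intros Hw.
  assert (Hpow : forall k, analytic_on_disk (fun z => z ^ k * w z)%C).
  { induction k as [|k [a Ha]].
    - destruct Hw as [a Ha]. exists a. apply (expansion_ext w _ a a); auto.
      intros z _. simpl. ring.
    - eexists. eapply expansion_ext; [|reflexivity|apply expansion_shift, Ha].
      intros z _. simpl. ring. }
  induction K as [|K [b Hb]].
  - destruct Hw as [a Ha]. exists (fun k => RtoC 0 * a k)%C.
    apply (expansion_ext (fun z => RtoC 0 * w z)%C _ (fun k => RtoC 0 * a k)%C _);
      [|reflexivity|now apply expansion_scal].
    intros z _. simpl. ring.
  - destruct (Hpow K) as [a Ha]. exists (fun k => b k + g K * a k)%C.
    eapply expansion_ext;
      [|reflexivity|apply expansion_plus; [exact Hb|apply expansion_scal; exact Ha]].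
    intros z _. simpl. ring.
Qed.

(* The multiplier [w] contracts the l^2 norm of coefficients; testing this on
   the truncated Szego kernel of [zeta] evaluates [w] at [zeta]. *)
Lemma Schwarz_lemma (w : C -> C) :
  analytic_on_disk w -> w (RtoC 0) = RtoC 0 ->
  (forall z, disk z -> disk (w z)) ->
  forall z, disk z -> Cmod (w z) <= Cmod z.
Proof.
  intros Hw H0 Hd z Hz.
  assert (Hz0 := Cmod_ge_0 z). set (s := Cmod z) in *.
  assert (Hs1 : s < 1) by exact Hz.
  set (rho := s ^ 2). assert (Hrho : 0 <= rho < 1) by (unfold rho; simpl; nra).
  assert (Hwz := Cmod_ge_0 (w z)).
  assert (Hw1 : Cmod (w z) < 1) by (apply Hd; auto).
  assert (Hmain : forall K, (1 - rho ^ K) * Cmod (w z) <= s).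
  { intros K.
    set (g := fun k => (Cconj z ^ k)%C).
    set (SK := rsum (fun k => rho ^ k) K).
    assert (ESK : (1 - rho) * SK = 1 - rho ^ K).
    { unfold SK. clear. induction K as [|K IH]; simpl; [ring|].
      rewrite Rmult_plus_distr_l, IH. ring. }
    assert (Eg : rsum (fun k => Cmod (g k) ^ 2) K = SK).
    { apply rsum_ext. intros k _. unfold g. rewrite Cmod_pow, Cmod_conj.
      fold s. unfold rho. rewrite <- !pow_mult. f_equal. lia. }
    assert (EG : csum (fun k => g k * z ^ k)%C K = RtoC SK).
    { unfold SK. clear Eg ESK SK. induction K as [|K IH]; [reflexivity|].
      simpl. rewrite IH, RtoC_plus. f_equal. unfold g.
      rewrite <- Cpow_mult_l, (Cmult_comm (Cconj z)), <- Cmod2_conj.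
      symmetry. apply RtoC_pow. }
    destruct (analytic_mult_poly w g K Hw) as [e He].
    assert (He0 : e 0%nat = RtoC 0).
    { rewrite <- (expansion_0 _ _ He), H0. ring. }
    assert (Hcon : forall n, rsum (fun k => Cmod (e k) ^ 2) n <= SK).
    { intros n. rewrite <- Eg.
      apply (multiplier_contraction w (fun z => w z * csum (fun k => g k * z ^ k) K)%C);
        auto.
      intros y Hy. left. now apply Hd. }
    (* Since e_0 = 0, every term is |e_(k+1)| s^(k+1) <= (s/2) (|e_(k+1)|^2 + rho^k): the missing
       constant term is what gains the factor s. Multiplied by 1 - rho, the bound becomes (1 -
       rho^K) |w z| <= (s/2) (2 - rho^K) <= s. *)
    assert (Hval : Cmod (w z * RtoC SK - RtoC 0) <= s / 2 * (SK + / (1 - rho))).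
    { apply (Cmod_le_limit (fun k => e k * z ^ k)%C _ _ _ 0).
      { apply is_pseries_C_iff. rewrite <- EG. apply (He z Hz). }
      intros n _. replace (csum (fun k => e k * z ^ k)%C n - RtoC 0)%C
        with (csum (fun k => e k * z ^ k)%C n) by ring.
      eapply Rle_trans; [apply Cmod_csum|].
      apply Rle_trans with (s / 2 * (SK + rsum (fun k => rho ^ k) (pred n))).
      2:{ apply Rmult_le_compat_l; [lra|]. apply Rplus_le_compat_l.
          now apply geom_sum_bound. }
      apply Rle_trans with (s / 2 * (rsum (fun k => Cmod (e k) ^ 2) n
                                     + rsum (fun k => rho ^ k) (pred n))).
      2:{ apply Rmult_le_compat_l; [lra|]. apply Rplus_le_compat_r, Hcon. }
      destruct n as [|n]; [simpl; lra|].
      induction n as [|n IH].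
      - simpl. rewrite He0, Cmult_0_l, Cmod_0. lra.
      - change (rsum (fun k => Cmod (e k * z ^ k)) (S n) + Cmod (e (S n) * z ^ S n)
                <= s / 2 * ((rsum (fun k => Cmod (e k) ^ 2) (S n) + Cmod (e (S n)) ^ 2)
                            + (rsum (fun k => rho ^ k) n + rho ^ n))).
        simpl pred in IH.
        assert (Ht : Cmod (e (S n) * z ^ S n) <= s / 2 * (Cmod (e (S n)) ^ 2 + rho ^ n)).
        { rewrite Cmod_mult, Cmod_pow. fold s. unfold rho.
          rewrite <- pow_mult, Nat.mul_comm, pow_mult. simpl.
          assert (0 <= (Cmod (e (S n)) - s ^ n) ^ 2) by apply pow2_ge_0.
          nra. }
        lra. }
    replace (w z * RtoC SK - RtoC 0)%C with (w z * RtoC SK)%C in Hval by ring.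
    assert (HSK : 0 <= SK) by (apply rsum_ge_0; intros; apply pow_le; lra).
    rewrite Cmod_mult, Cmod_R, (Rabs_right SK) in Hval by lra.
    apply (Rmult_le_compat_l (1 - rho)) in Hval; [|lra].
    replace ((1 - rho) * (s / 2 * (SK + / (1 - rho))))
      with (s / 2 * ((1 - rho) * SK + 1)) in Hval by (field; lra).
    replace ((1 - rho) * (Cmod (w z) * SK)) with (Cmod (w z) * ((1 - rho) * SK))
      in Hval by ring.
    rewrite ESK in Hval.
    assert (0 <= rho ^ K) by (apply pow_le; lra). nra. }
  apply (le_of_small_error _ _ 1); [lra|]. intros t Ht.
  destruct (pow_lt_1_zero rho) with t as [K HK]; [rewrite Rabs_right; lra|lra|].
  specialize (HK K (Nat.le_refl K)). specialize (Hmain K).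
  apply Rabs_def2 in HK. nra.
Qed.

(** Replacing Q by its first n terms changes w Q by w times O(|z|^n), and |w z| <= |z| raises this
    to O(|z|^(n+1)). So the coefficients of P up to index n are those of w times a polynomial, to
    which the contraction applies; the extra index on the left is the gain from w 0 = 0. *)
Lemma Clunie_inequality (P Q w : C -> C) (p q : nat -> C) (n : nat) :
  has_expansion P p -> has_expansion Q q ->
  analytic_on_disk w -> w (RtoC 0) = RtoC 0 ->
  (forall z, disk z -> disk (w z)) ->
  (forall z, disk z -> P z = (w z * Q z)%C) ->
  rsum (fun k => Cmod (p k) ^ 2) (S n) <= rsum (fun k => Cmod (q k) ^ 2) n.
Proof.
  intros HP HQ Hw H0 Hd E.
  destruct (analytic_mult_poly w q n Hw) as [e He].
  assert (Hep : forall k, (k < S n)%nat -> p k = e k).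
  { destruct (expansion_order_bound _ _ n (expansion_truncate Q q n HQ)) as [K [HK0 HK]].
    { intros j Hj. destruct (Nat.ltb_spec j n); [reflexivity|lia]. }
    intros k Hk. apply Ceq_minus.
    apply (expansion_contact _ _ (S n) K (expansion_minus _ _ _ _ HP He)); auto.
    intros z Hz. assert (Hz1 : disk z) by (unfold disk; lra).
    rewrite E by auto. specialize (HK z Hz).
    assert (Hs := Schwarz_lemma w Hw H0 Hd z Hz1).
    replace (w z * Q z - w z * csum (fun k => q k * z ^ k) n)%C
      with (w z * (Q z - csum (fun k => q k * z ^ k) n))%C by ring.
    rewrite Cmod_mult. simpl.
    apply Rle_trans with (Cmod z * (K * Cmod z ^ n)); [|lra].
    apply Rmult_le_compat; auto; apply Cmod_ge_0. }
  rewrite (rsum_ext _ (fun k => Cmod (e k) ^ 2)) by (intros k Hk; now rewrite Hep).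
  apply (multiplier_contraction w (fun z => w z * csum (fun k => q k * z ^ k) n)%C); auto.
  intros z Hz. left. now apply Hd.
Qed.

(** * First-order expansions and attained values *)

(** An explicit quadratic remainder serves alike for complex derivatives, derivatives along rays,
    continuity, and the choice of step size at a minimum. *)
Definition first_order_at (f : C -> C) (z l : C) : Prop :=
  exists K d, 0 <= K /\ 0 < d /\ forall h, Cmod h <= d ->
    Cmod (f (z + h)%C - f z - h * l) <= K * Cmod h ^ 2.

(** The factor s^2 on the left avoids the exponent n - 2. The remainders satisfy D_(n+1) = (z + h)
    D_n + n h^2 z^(n-1), and n^2 + n <= (n+1)^2 closes the induction. *)
Lemma Cpow_first_order (z h : C) (s : R) (n : nat) :
  Cmod z + Cmod h <= s ->
  Cmod ((z + h) ^ n - z ^ n - h * (RtoC (INR n) * z ^ pred n)) * s ^ 2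
  <= INR n * INR n * s ^ n * Cmod h ^ 2.
Proof.
  intros Hs. assert (Hz := Cmod_ge_0 z). assert (Hh := Cmod_ge_0 h).
  induction n as [|n IH].
  - simpl. replace (1 - 1 - h * (0 * 1))%C with (RtoC 0) by ring. rewrite Cmod_0. lra.
  - set (D := ((z + h) ^ n - z ^ n - h * (RtoC (INR n) * z ^ pred n))%C) in *.
    assert (E : ((z + h) ^ S n - z ^ S n - h * (RtoC (INR (S n)) * z ^ pred (S n))
                 = (z + h) * D + h * h * (RtoC (INR n) * z ^ pred n))%C).
    { rewrite S_INR, RtoC_plus. unfold D. destruct n as [|n]; simpl; ring. }
    rewrite E, S_INR.
    assert (Hn := pos_INR n).
    assert (Hsn : 0 <= s ^ n) by (apply pow_le; lra).
    assert (HD0 := Cmod_ge_0 D).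
    assert (HzhD : Cmod ((z + h) * D) <= s * Cmod D).
    { rewrite Cmod_mult. apply Rmult_le_compat_r; [auto|].
      eapply Rle_trans; [apply Cmod_triangle|auto]. }
    assert (Hlast : Cmod (h * h * (RtoC (INR n) * z ^ pred n)) * s ^ 2
                    <= INR n * s ^ S n * Cmod h ^ 2).
    { rewrite !Cmod_mult, Cmod_pow, Cmod_R, Rabs_right by lra.
      destruct n as [|n]; [simpl; lra|]. simpl pred.
      assert (Cmod z ^ n <= s ^ n) by (apply pow_incr; lra).
      replace (Cmod h * Cmod h * (INR (S n) * Cmod z ^ n) * s ^ 2)
        with ((INR (S n) * s ^ 2 * Cmod h ^ 2) * Cmod z ^ n) by ring.
      replace (INR (S n) * s ^ S (S n) * Cmod h ^ 2)
        with ((INR (S n) * s ^ 2 * Cmod h ^ 2) * s ^ n) by (simpl; ring).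
      apply Rmult_le_compat_l; auto.
      apply Rmult_le_pos; [apply Rmult_le_pos; [auto|]|]; apply pow2_ge_0. }
    assert (Ht := Cmod_triangle ((z + h) * D) (h * h * (RtoC (INR n) * z ^ pred n))).
    apply Rle_trans with (s * (Cmod D * s ^ 2) + INR n * s ^ S n * Cmod h ^ 2).
    + eapply Rle_trans; [apply Rmult_le_compat_r; [apply pow2_ge_0|exact Ht]|].
      rewrite Rmult_plus_distr_r. apply Rplus_le_compat; [|exact Hlast].
      rewrite <- Rmult_assoc. apply Rmult_le_compat_r; [apply pow2_ge_0|exact HzhD].
    + apply (Rmult_le_compat_l s) in IH; [|lra].
      assert (0 <= s * s ^ n * Cmod h ^ 2).
      { repeat apply Rmult_le_pos; try apply pow2_ge_0; lra. }
      simpl pow in *. nra.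
Qed.

Definition derived (a : nat -> C) (k : nat) : C := (RtoC (INR (S k)) * a (S k))%C.

Lemma expansion_first_order (f : C -> C) (a : nat -> C) (z l : C) :
  has_expansion f a -> disk z ->
  @is_pseries C_AbsRing C_NormedModule (derived a) z l ->
  first_order_at f z l.
Proof.
  intros Hf Hz Hl. assert (Hz0 := Cmod_ge_0 z).
  (* Chosen so that |z| + d = s < 1: all increments allowed stay in the disk of radius s. *)
  set (s := (1 + Cmod z) / 2). set (d := (1 - Cmod z) / 2).
  unfold disk in Hz.
  assert (Hs : 0 < s < 1) by (unfold s; lra).
  assert (Hd : 0 < d) by (unfold d; lra).
  assert (Hc := temperate_INR _ (temperate_INR _ (expansion_temperate f a Hf))).
  set (c := fun n => INR n * (INR n * Cmod (a n))) in *.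
  assert (He := temperate_series c s Hc ltac:(lra)).
  assert (Hpos : forall k, 0 <= c k * s ^ k).
  { intros k. apply Rmult_le_pos; [apply Hc|apply pow_le; lra]. }
  set (T := Series (fun n => c n * s ^ n)).
  assert (HT : 0 <= T) by (apply (rsum_le_Series _ 0 Hpos He)).
  exists (T / s ^ 2), d. split; [|split; [auto|]].
  { apply Rdiv_le_0_compat; [auto|apply pow_lt; lra]. }
  intros h Hh.
  assert (Hzh : disk (z + h)).
  { unfold disk. eapply Rle_lt_trans; [apply Cmod_triangle|]. unfold d in Hh. lra. }
  (* The derived series is padded with a zero term, so that its n-th term n a_n z^(n-1) lines up
     with the n-th terms of f (z + h) and f z. *)
  assert (Hdl : @is_series C_AbsRing C_NormedModule
                  (fun n => RtoC (INR n) * a n * z ^ pred n)%C l).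
  { apply is_series_C_iff. intros eps Heps.
    apply is_pseries_C_iff in Hl.
    destruct (proj1 (is_series_C_iff _ _) Hl eps Heps) as [n0 Hn0].
    exists (S n0). intros [|n] Hn; [lia|].
    specialize (Hn0 n ltac:(lia)).
    replace (csum _ (S n)) with (csum (fun k => derived a k * z ^ k)%C n); [exact Hn0|].
    clear. induction n as [|n IH]; [simpl; ring|].
    cbn [csum] in *. rewrite IH. reflexivity. }
  assert (H1 := proj1 (is_pseries_C_iff _ _ _) (Hf _ Hzh)).
  assert (H2 := proj1 (is_pseries_C_iff _ _ _) (Hf z Hz)).
  assert (H3 := is_series_scal h _ _ Hdl).
  assert (H4 := is_series_minus _ _ _ _ (is_series_minus _ _ _ _ H1 H2) H3).
  replace (f (z + h)%C - f z - h * l)%C with (f (z + h)%C - f z - h * l - RtoC 0)%C by ring.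
  apply (Cmod_le_limit _ _ _ _ 0 H4). intros n _.
  match goal with |- Cmod (?x - _) <= _ => replace (x - RtoC 0)%C with x by ring end.
  eapply Rle_trans; [apply Cmod_csum|].
  apply Rle_trans with (rsum (fun k => Cmod h ^ 2 / s ^ 2 * (c k * s ^ k)) n).
  - apply rsum_le. intros k _.
    change (Cmod (a k * (z + h) ^ k - a k * z ^ k
                  - h * (RtoC (INR k) * a k * z ^ pred k))
            <= Cmod h ^ 2 / s ^ 2 * (c k * s ^ k)).
    replace (a k * (z + h) ^ k - a k * z ^ k - h * (RtoC (INR k) * a k * z ^ pred k))%C
      with (a k * ((z + h) ^ k - z ^ k - h * (RtoC (INR k) * z ^ pred k)))%C by ring.
    rewrite Cmod_mult.
    assert (Hp := Cpow_first_order z h s k).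
    set (D := Cmod ((z + h) ^ k - z ^ k - h * (RtoC (INR k) * z ^ pred k))) in *.
    assert (Hs2 : 0 < s ^ 2) by (apply pow_lt; lra).
    apply Rmult_le_reg_r with (s ^ 2); [auto|].
    replace (Cmod h ^ 2 / s ^ 2 * (c k * s ^ k) * s ^ 2)
      with (Cmod (a k) * (INR k * INR k * s ^ k * Cmod h ^ 2))
      by (unfold c; field; lra).
    rewrite Rmult_assoc. apply Rmult_le_compat_l; [apply Cmod_ge_0|].
    apply Hp. unfold s, d in *. lra.
  - rewrite rsum_scal.
    replace (T / s ^ 2 * Cmod h ^ 2) with (Cmod h ^ 2 / s ^ 2 * T) by (field; lra).
    apply Rmult_le_compat_l.
    + apply Rdiv_le_0_compat; [apply pow2_ge_0|apply pow_lt; lra].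
    + now apply rsum_le_Series.
Qed.

Lemma first_order_is_derive (f : C -> C) (z l : C) :
  first_order_at f z l -> @is_derive C_AbsRing C_NormedModule f z l.
Proof.
  intros [K [d [HK [Hd H]]]]. split.
  - apply (is_linear_scal_l (K := C_AbsRing) (V := C_NormedModule)).
  - intros x Hx.
    rewrite <- (is_filter_lim_locally_unique (V := AbsRing_NormedModule C_AbsRing) z x Hx).
    intros [eps Heps]. clear x Hx.
    assert (Hr : 0 < Rmin d (eps / (K + 1))).
    { apply Rmin_glb_lt; [auto|]. apply Rdiv_lt_0_compat; lra. }
    apply (locally_le_locally_norm (V := AbsRing_NormedModule C_AbsRing)).
    exists (mkposreal _ Hr). intros y Hy. change C in y.
    change (Cmod (y - z) < Rmin d (eps / (K + 1))) in Hy.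
    change (Cmod (f y - f z - (y - z) * l) <= eps * Cmod (y - z)).
    assert (Hy1 : Cmod (y - z) < d) by (eapply Rlt_le_trans; [exact Hy|apply Rmin_l]).
    assert (Hy2 : Cmod (y - z) < eps / (K + 1))
      by (eapply Rlt_le_trans; [exact Hy|apply Rmin_r]).
    specialize (H (y - z)%C ltac:(lra)).
    replace (z + (y - z))%C with y in H by ring.
    eapply Rle_trans; [exact H|].
    assert (H0 := Cmod_ge_0 (y - z)).
    apply (Rmult_lt_compat_l (K + 1)) in Hy2; [|lra].
    replace ((K + 1) * (eps / (K + 1))) with eps in Hy2 by (field; lra).
    simpl. nra.
Qed.

Lemma derived_temperate (a : nat -> C) :
  temperate (fun n => Cmod (a n)) -> temperate (fun n => Cmod (derived a n)).
Proof.
  intros Ha. assert (H := temperate_INR _ Ha). destruct H as [H0 H]. split.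
  - intros; apply Cmod_ge_0.
  - intros r Hr. destruct (Req_dec r 0) as [->|Hr0].
    + exists (Cmod (derived a 0)). intros [|n]; [simpl; lra|].
      rewrite pow_i by lia. assert (H1 := Cmod_ge_0 (derived a 0)). lra.
    + destruct (H r Hr) as [B HB]. exists (B / r). intros n.
      specialize (HB (S n)). unfold derived.
      rewrite Cmod_mult, Cmod_R, Rabs_right by (apply Rle_ge, pos_INR).
      apply Rmult_le_reg_r with r; [lra|].
      replace (B / r * r) with B by (field; lra). simpl pow in HB. lra.
Qed.

Lemma expansion_C_derive (f : C -> C) (a : nat -> C) :
  has_expansion f a ->
  has_expansion (C_derive f) (derived a) /\
  forall z, disk z -> first_order_at f z (C_derive f z).
Proof.
  intros Hf.
  assert (H : forall z, disk z ->
    @is_pseries C_AbsRing C_NormedModule (derived a) z (C_derive f z)).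
  { intros z Hz.
    destruct (temperate_ex_pseries (derived a) z) as [l Hl]; auto.
    { apply derived_temperate. now apply (expansion_temperate f). }
    rewrite (is_C_derive_unique f z l); auto.
    apply first_order_is_derive. now apply (expansion_first_order f a). }
  split; [exact H|].
  intros z Hz. apply (expansion_first_order f a); auto.
Qed.

(** * Minima on closed disks and attained values *)

Lemma Cmod_le_Rabs (z : C) : Cmod z <= Rabs (Re z) + Rabs (Im z).
Proof.
  assert (H : 0 <= Rabs (Re z) + Rabs (Im z))
    by (apply Rplus_le_le_0_compat; apply Rabs_pos).
  apply Rsqr_incr_0_var; [|exact H].
  rewrite !Rsqr_pow2, Cmod2_alt.
  assert (H1 := Rabs_pos (Re z)). assert (H2 := Rabs_pos (Im z)).
  rewrite <- (pow2_abs (Re z)), <- (pow2_abs (Im z)). nra.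
Qed.

Lemma im_le_Cmod (z : C) : Rabs (Im z) <= Cmod z.
Proof.
  eapply Rle_trans; [|apply Rmax_Cmod]. apply Rmax_r.
Qed.

(** Lower semicontinuity suffices. Were the infimum not attained, each point would have a
    neighbourhood on which g exceeds the infimum by a fixed amount; compactness of the enclosing
    square makes the amount uniform, contradicting the infimum. *)
Lemma closed_disk_min (g : C -> R) (r : R) :
  0 <= r -> (forall z, 0 <= g z) ->
  (forall z, Cmod z <= r -> forall eps, 0 < eps -> exists d, 0 < d /\
     forall y, Cmod y <= r -> Cmod (y - z) < d -> g z - eps <= g y) ->
  exists z0, Cmod z0 <= r /\ forall z, Cmod z <= r -> g z0 <= g z.
Proof.
  intros Hr Hg Hc. apply NNPP. intros Hno.
  assert (Hlow : forall z0, Cmod z0 <= r -> exists z, Cmod z <= r /\ g z < g z0).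
  { intros z0 Hz0. apply NNPP. intros H. apply Hno. exists z0. split; auto.
    intros z Hz. apply Rnot_lt_le. intros Hlt. apply H. exists z. auto. }
  destruct (completeness (fun x => exists z, Cmod z <= r /\ x = - g z)) as [s [Hub Hlub]].
  { exists 0. intros x [z [_ ->]]. specialize (Hg z). lra. }
  { exists (- g (RtoC 0)), (RtoC 0). rewrite Cmod_0. auto. }
  assert (Hs : forall z, Cmod z <= r -> - s < g z).
  { intros z Hz. destruct (Hlow z Hz) as [y [Hy Hyz]].
    assert (H := Hub (- g y) (ex_intro _ y (conj Hy eq_refl))). lra. }
  (* Here -s is the infimum of g. One number d is both the size of the neighbourhood and the gain
     over -s, so only one quantity has to be made uniform. *)
  assert (Hdelta : forall t : Compactness.Tn 2 R, exists d : posreal, forall y,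
    Cmod y <= r -> Rabs (Re y - fst t) < d -> Rabs (Im y - fst (snd t)) < d ->
    - s + d <= g y).
  { intros [t1 [t2 []]]. simpl fst; simpl snd. set (t := (t1, t2) : C).
    assert (Hsup : forall y d, Rabs (Re y - t1) < d / 2 -> Rabs (Im y - t2) < d / 2 ->
              Cmod (y - t) < d).
    { intros y d H1 H2. eapply Rle_lt_trans; [apply Cmod_le_Rabs|].
      replace (Re (y - t)) with (Re y - t1) by reflexivity.
      replace (Im (y - t)) with (Im y - t2) by reflexivity. lra. }
    destruct (Rle_lt_dec (Cmod t) r) as [Ht|Ht].
    - assert (Hst := Hs t Ht).
      destruct (Hc t Ht ((g t + s) / 2) ltac:(lra)) as [d [Hd Hd']].
      assert (Hm : 0 < Rmin (d / 2) ((g t + s) / 2)) by (apply Rmin_glb_lt; lra).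
      exists (mkposreal _ Hm). simpl. intros y Hy H1 H2.
      assert (Hm1 := Rmin_l (d / 2) ((g t + s) / 2)).
      assert (Hm2 := Rmin_r (d / 2) ((g t + s) / 2)).
      specialize (Hd' y Hy (Hsup y d ltac:(lra) ltac:(lra))). lra.
    (* A centre outside the disk has a neighbourhood missing the disk, and the requirement is
       vacuous. *)
    - assert (Hm : 0 < (Cmod t - r) / 2) by lra.
      exists (mkposreal _ Hm). simpl. intros y Hy H1 H2. exfalso.
      assert (H3 := Hsup y (Cmod t - r) H1 H2).
      assert (H4 := Cmod_triangle_minus t y). rewrite Cmod_minus_sym in H4. lra. }
  apply functional_choice in Hdelta. destruct Hdelta as [delta Hdelta].
  destruct (compactness_value 2 (- r, (- r, tt)) (r, (r, tt)) delta) as [d Hd].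
  assert (Hgd : forall y, Cmod y <= r -> - s + d <= g y).
  (* [compactness_value] provides the nearby centre only under a double negation. *)
  { intros y Hy. apply NNPP. intros Hny.
    apply (Hd (Re y, (Im y, tt))).
    - assert (H1 := re_le_Cmod y). assert (H2 := im_le_Cmod y).
      assert (H3 : Rabs (Re y) <= r) by lra. assert (H4 : Rabs (Im y) <= r) by lra.
      apply Rabs_le_between in H3. apply Rabs_le_between in H4.
      simpl. auto.
    - intros [[t1 [t2 []]] [_ [Hclose Hdt]]]. apply Hny.
      simpl in Hclose. destruct Hclose as [H1 [H2 _]].
      specialize (Hdelta (t1, (t2, tt)) y Hy H1 H2).
      eapply Rle_trans; [|exact Hdelta]. apply Rplus_le_compat_l. exact Hdt. }
  assert (Hcontra : s <= s - d).
  { apply Hlub. intros x [z [Hz ->]]. specialize (Hgd z Hz). lra. }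
  destruct d as [d Hd0]. simpl in Hcontra. lra.
Qed.

Lemma small_witness (x y z : R) :
  0 < x -> 0 < y -> 0 < z -> exists t, 0 < t /\ t <= x /\ t <= y /\ t <= z.
Proof.
  intros. exists (Rmin x (Rmin y z)).
  assert (H2 := Rmin_l x (Rmin y z)). assert (H3 := Rmin_r x (Rmin y z)).
  assert (H4 := Rmin_l y z). assert (H5 := Rmin_r y z).
  repeat split; try lra. repeat apply Rmin_glb_lt; auto.
Qed.

(* A minimum point of [|f - v|] inside the disk is a solution of [f z = v],
   since a nonzero derivative allows a step towards [v]. *)
Lemma value_attained (f : C -> C) (r : R) (v z1 : C) :
  (forall z, Cmod z <= r -> exists l, l <> RtoC 0 /\ first_order_at f z l) ->
  Cmod z1 <= r ->
  (forall z, Cmod z = r -> Cmod (f z1 - v) < Cmod (f z - v)) ->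
  exists z, Cmod z <= r /\ f z = v.
Proof.
  intros Hf Hz1 Hbd.
  assert (Hr : 0 <= r) by (assert (H := Cmod_ge_0 z1); lra).
  destruct (closed_disk_min (fun z => Cmod (f z - v)) r) as [z0 [Hz0 Hmin]]; auto.
  { intros; apply Cmod_ge_0. }
  { intros z Hz eps Heps. destruct (Hf z Hz) as [l [_ [K [d [HK [Hd H]]]]]].
    assert (Hl := Cmod_ge_0 l).
    destruct (small_witness d 1 (eps / (K + Cmod l + 1))) as [t [Ht [H1 [H2 H3]]]];
      [auto|lra|apply Rdiv_lt_0_compat; lra|].
    exists t. split; auto. intros y _ Hy.
    set (h := (y - z)%C) in *. specialize (H h ltac:(lra)).
    replace (z + h)%C with y in H by (unfold h; ring).
    assert (Hh := Cmod_ge_0 h).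
    assert (Hdist : Cmod (f y - f z) <= eps).
    { replace (f y - f z)%C with (f y - f z - h * l + h * l)%C by ring.
      eapply Rle_trans; [apply Cmod_triangle|]. rewrite Cmod_mult.
      apply (Rmult_le_compat_l (K + Cmod l + 1)) in H3; [|lra].
      replace ((K + Cmod l + 1) * (eps / (K + Cmod l + 1))) with eps in H3 by (field; lra).
      assert (K * Cmod h ^ 2 <= K * Cmod h).
      { apply Rmult_le_compat_l; [auto|]. simpl. nra. }
      nra. }
    assert (Ht2 := Cmod_triangle_minus (f z - v) (f z - f y)).
    replace (f z - v - (f z - f y))%C with (f y - v)%C in Ht2 by ring.
    rewrite (Cmod_minus_sym (f z) (f y)) in Ht2. lra. }
  exists z0. split; auto.
  apply NNPP. intros Hne.
  set (e := (f z0 - v)%C).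
  assert (He : 0 < Cmod e) by (apply Cmod_gt_0, Cminus_eq_contra; auto).
  assert (Hlt : Cmod z0 < r).
  { destruct (Rle_lt_or_eq_dec _ _ Hz0) as [|Heq]; auto.
    assert (H1 := Hbd z0 Heq). assert (H2 := Hmin z1 Hz1). simpl in H2. lra. }
  destruct (Hf z0 Hz0) as [l [Hl0 [K [d [HK [Hd H]]]]]].
  assert (Hl : 0 < Cmod l) by now apply Cmod_gt_0.
  set (q := Cmod e / Cmod l).
  assert (Hq : 0 < q) by (apply Rdiv_lt_0_compat; auto).
  (* The step h = -t e / l takes e to (1 - t) e at first order. For t <= m the remainder K (t q)^2
     is at most t |e| / 2, less than the gain t |e|. *)
  set (m := Rmin (1 / 2) (Cmod e / (2 * (K + 1) * q ^ 2))).
  assert (Hm : 0 < m).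
  { unfold m. apply Rmin_glb_lt; [lra|]. apply Rdiv_lt_0_compat; auto.
    apply Rmult_lt_0_compat; [lra|apply pow_lt; auto]. }
  destruct (small_witness (d / q) ((r - Cmod z0) / q) m) as [t [Ht [H1 [H2 H3]]]];
    try (apply Rdiv_lt_0_compat; lra); auto.
  assert (Hm1 : m <= 1 / 2) by apply Rmin_l.
  assert (Hm2 : m <= Cmod e / (2 * (K + 1) * q ^ 2)) by apply Rmin_r.
  set (h := (- (RtoC t * (e / l)))%C).
  assert (Hh : Cmod h = t * q).
  { unfold h, q. rewrite Cmod_opp, Cmod_mult, Cmod_R, Rabs_right, Cmod_div by (auto; lra).
    reflexivity. }
  assert (Hhd : Cmod h <= d).
  { rewrite Hh. apply (Rmult_le_compat_r q) in H1; [|lra].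
    replace (d / q * q) with d in H1 by (field; lra). lra. }
  assert (Hhr : Cmod (z0 + h) <= r).
  { eapply Rle_trans; [apply Cmod_triangle|]. rewrite Hh.
    apply (Rmult_le_compat_r q) in H2; [|lra].
    replace ((r - Cmod z0) / q * q) with (r - Cmod z0) in H2 by (field; lra). lra. }
  specialize (H h Hhd). specialize (Hmin (z0 + h)%C Hhr). cbv beta in Hmin. fold e in Hmin.
  assert (E : (f (z0 + h)%C - v = RtoC (1 - t) * e + (f (z0 + h)%C - f z0 - h * l))%C).
  { unfold h, e. rewrite RtoC_minus. field. auto. }
  assert (Htri := Cmod_triangle (RtoC (1 - t) * e) (f (z0 + h)%C - f z0 - h * l)).
  rewrite <- E in Htri. rewrite Cmod_mult, Cmod_R, Rabs_right in Htri by lra.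
  rewrite Hh in H.
  assert (Hq2 : 0 < 2 * (K + 1) * q ^ 2).
  { apply Rmult_lt_0_compat; [lra|apply pow_lt; auto]. }
  assert (H4 : t * (2 * (K + 1) * q ^ 2) <= Cmod e).
  { apply Rle_trans with (Cmod e / (2 * (K + 1) * q ^ 2) * (2 * (K + 1) * q ^ 2)).
    - apply Rmult_le_compat_r; lra.
    - right. field. split; [lra|]. lra. }
  assert (H5 : K * (t * q) ^ 2 <= t * (Cmod e / 2)).
  { rewrite Rpow_mult_distr.
    replace (K * (t ^ 2 * q ^ 2)) with (t * (t * (K * q ^ 2))) by ring.
    apply Rmult_le_compat_l; [lra|].
    assert (0 < q ^ 2) by (apply pow_lt; auto). nra. }
  nra.
Qed.

(** * Starlike functions *)

Lemma disk_1_minus (z : C) : disk z -> (1 - z)%C <> RtoC 0.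
Proof.
  intros Hz H. apply Ceq_minus in H. subst z. unfold disk in Hz.
  rewrite Cmod_1 in Hz. lra.
Qed.

Lemma disk_1_plus (z : C) : disk z -> (1 + z)%C <> RtoC 0.
Proof.
  intros Hz H. unfold disk in Hz.
  replace z with (- (1))%C in Hz.
  - rewrite Cmod_m1 in Hz. lra.
  - transitivity ((1 + z) - 1)%C; [rewrite H|]; ring.
Qed.

Lemma disk_0 : disk (RtoC 0).
Proof. unfold disk. rewrite Cmod_0. lra. Qed.

Lemma starlike_0 (f : C -> C) (a : nat -> C) : starlike f a -> f (RtoC 0) = RtoC 0.
Proof. intros [Hf [H0 _]]. rewrite (expansion_0 f a Hf). exact H0. Qed.

Lemma starlike_neq_0 (f : C -> C) (a : nat -> C) (z : C) :
  starlike f a -> disk z -> z <> RtoC 0 -> f z <> RtoC 0.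
Proof.
  intros Hs Hz Hz0 H. apply Hz0.
  destruct Hs as [Hf [H0 [H1 [Hu Hsub]]]]. apply Hu; auto using disk_0.
  rewrite H, (expansion_0 f a Hf). auto.
Qed.

(** Clearing denominators makes the relation hold at 0 too, where the quotient is filled in by
    convention. *)
Lemma starlike_equation (f : C -> C) (a : nat -> C) :
  starlike f a ->
  exists w : C -> C, analytic_on_disk w /\ w (RtoC 0) = RtoC 0 /\
    (forall z, disk z -> disk (w z)) /\
    forall z, disk z ->
      (z * C_derive f z * (1 - w z))%C = (f z * (1 + w z))%C.
Proof.
  intros Hs. assert (H := Hs). destruct H as [Hf [_ [_ [_ [w [Hw [Hw0 [Hwd Hq]]]]]]]].
  exists w. repeat split; auto. intros z Hz.
  specialize (Hq z Hz). unfold starlike_quotient in Hq.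
  destruct (Ceq_dec z (RtoC 0)) as [->|Hz0].
  - rewrite (starlike_0 f a Hs). ring.
  - assert (Hfz := starlike_neq_0 f a z Hs Hz Hz0).
    assert (Hwz := disk_1_minus _ (Hwd z Hz)).
    transitivity (f z * (1 - w z) * (z * C_derive f z / f z))%C; [field; auto|].
    rewrite Hq. field. auto.
Qed.

(** Away from 0 a zero of f' would give f z (1 + w z) = 0, and neither factor vanishes. This
    bypasses the general theorem on derivatives of univalent functions. *)
Lemma starlike_derive_neq_0 (f : C -> C) (a : nat -> C) (z : C) :
  starlike f a -> disk z -> C_derive f z <> RtoC 0.
Proof.
  intros Hs Hz H.
  destruct (Ceq_dec z (RtoC 0)) as [->|Hz0].
  - destruct Hs as [Hf [_ [H1 _]]].
    rewrite (expansion_0 _ _ (proj1 (expansion_C_derive f a Hf))) in H.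
    unfold derived in H. simpl in H. rewrite H1 in H. apply C1_nz. rewrite <- H. ring.
  - destruct (starlike_equation f a Hs) as [w [_ [_ [Hwd E]]]].
    specialize (E z Hz). rewrite H in E.
    apply (Cmult_neq_0 (f z) (1 + w z)).
    + now apply (starlike_neq_0 f a).
    + now apply disk_1_plus, Hwd.
    + rewrite <- E. ring.
Qed.

Lemma rsum_cubes (n : nat) :
  rsum (fun k => 4 * INR k * INR k ^ 2) n = (INR n * (INR n - 1)) ^ 2.
Proof.
  induction n as [|n IH]; [simpl; ring|].
  cbn [rsum]. rewrite IH, S_INR. ring.
Qed.

Lemma starlike_coef_bound (f : C -> C) (a : nat -> C) :
  starlike f a -> forall n, Cmod (a n) <= INR n.
Proof.
  intros Hs.
  destruct (starlike_equation f a Hs) as [w [Hw [Hw0 [Hwd E]]]].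
  destruct Hs as [Hf [Ha0 [Ha1 _]]].
  destruct (expansion_C_derive f a Hf) as [Hd _].
  assert (Hzd : has_expansion (fun z => z * C_derive f z)%C (fun k => RtoC (INR k) * a k)%C).
  { eapply expansion_ext; [reflexivity| |apply expansion_shift, Hd].
    intros [|n]; [simpl; ring|reflexivity]. }
  assert (Hcl : forall n, rsum (fun k => Cmod (RtoC (INR k) * a k - a k) ^ 2) (S n)
                <= rsum (fun k => Cmod (RtoC (INR k) * a k + a k) ^ 2) n).
  { intros n.
    apply (Clunie_inequality (fun z => z * C_derive f z - f z)%C
             (fun z => z * C_derive f z + f z)%C w); auto.
    - now apply expansion_minus.
    - now apply expansion_plus.
    - intros z Hz. specialize (E z Hz). apply Ceq_minus.
      apply Ceq_minus in E. etransitivity; [|exact E]. ring. }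
  intros n. induction n as [n IH] using Wf_nat.lt_wf_ind.
  destruct n as [|[|n]].
  - rewrite Ha0, Cmod_0. simpl. lra.
  (* Index 1 is read off the normalisation: there the factor (n-1)^2 is 0 and Clunie's inequality
     says nothing. *)
  - rewrite Ha1, Cmod_1. simpl. lra.
  - set (p := S (S n)) in *.
    assert (Hp : 2 <= INR p).
    { unfold p. rewrite !S_INR. assert (H := pos_INR n). lra. }
    specialize (Hcl p). cbn [rsum] in Hcl.
    (* After this split the terms (k-1)^2 |a_k|^2 with k < p cancel on both sides, leaving (p-1)^2
       |a_p|^2 on the left. *)
    assert (Hdiff : forall k, Cmod (RtoC (INR k) * a k + a k) ^ 2
                     = Cmod (RtoC (INR k) * a k - a k) ^ 2 + 4 * INR k * Cmod (a k) ^ 2).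
    { intros k.
      replace (RtoC (INR k) * a k + a k)%C with (RtoC (INR k + 1) * a k)%C
        by (rewrite RtoC_plus; ring).
      replace (RtoC (INR k) * a k - a k)%C with (RtoC (INR k - 1) * a k)%C
        by (rewrite RtoC_minus; ring).
      rewrite !Cmod_mult, !Cmod_R, !Rpow_mult_distr, !pow2_abs. ring. }
    rewrite (rsum_ext (fun k => Cmod (RtoC (INR k) * a k + a k) ^ 2) _ p
               (fun k _ => Hdiff k)) in Hcl.
    rewrite rsum_plus in Hcl.
    assert (Hle : rsum (fun k => 4 * INR k * Cmod (a k) ^ 2) p
                  <= rsum (fun k => 4 * INR k * INR k ^ 2) p).
    { apply rsum_le. intros k Hk.
      assert (H0 := pos_INR k). apply Rmult_le_compat_l; [lra|].
      apply pow_incr. split; [apply Cmod_ge_0|now apply IH]. }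
    rewrite rsum_cubes in Hle.
    replace (RtoC (INR p) * a p - a p)%C with (RtoC (INR p - 1) * a p)%C in Hcl
      by (rewrite RtoC_minus; ring).
    rewrite Cmod_mult, Cmod_R, Rabs_right in Hcl by lra.
    assert (Hsq : ((INR p - 1) * Cmod (a p)) ^ 2 <= (INR p * (INR p - 1)) ^ 2) by lra.
    rewrite <- !Rsqr_pow2 in Hsq. apply Rsqr_incr_0_var in Hsq; [|nra].
    nra.
Qed.

(** Re ((1+w)/(1-w)) = (1-|w|^2)/|1-w|^2 is at least (1-|w|)/(1+|w|), which decreases in |w| <= |z|.
    Multiplying Re (z f'/f) by |f|^2 removes the division by f. *)
Lemma starlike_Re_bound (f : C -> C) (a : nat -> C) (z : C) :
  starlike f a -> disk z ->
  (1 - Cmod z) * Cmod (f z) ^ 2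
  <= (1 + Cmod z) * Re (z * C_derive f z * Cconj (f z)).
Proof.
  intros Hs Hz.
  destruct (starlike_equation f a Hs) as [w [Hw [Hw0 [Hwd E]]]].
  specialize (E z Hz).
  assert (Hsw := Schwarz_lemma w Hw Hw0 Hwd z Hz).
  set (Q := Re (z * C_derive f z * Cconj (f z))).
  set (A := Cmod (f z) ^ 2).
  set (s := Cmod (w z)) in *.
  assert (Hid : Q * Cmod (1 - w z) ^ 2 = A * (1 - s ^ 2)).
  { assert (Hc : (z * C_derive f z * Cconj (f z) * RtoC (Cmod (1 - w z) ^ 2))%C
                 = (RtoC A * ((1 + w z) * Cconj (1 - w z)))%C).
    { unfold A. rewrite !Cmod2_conj.
      transitivity (z * C_derive f z * (1 - w z) * (Cconj (f z) * Cconj (1 - w z)))%C;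
        [ring|]. rewrite E. ring. }
    apply (f_equal Re) in Hc. rewrite re_scal_r, re_scal_l in Hc. fold Q in Hc.
    rewrite Hc. f_equal. unfold s. rewrite Cmod2_alt.
    destruct (w z) as [x y]. simpl. ring. }
  assert (Hs0 : 0 <= s) by apply Cmod_ge_0.
  assert (Hs1 : s <= Cmod z) by exact Hsw.
  unfold disk in Hz.
  assert (HA : 0 <= A) by apply pow2_ge_0.
  assert (HD : 0 < Cmod (1 - w z)) by (apply Cmod_gt_0, disk_1_minus, Hwd; exact Hz).
  assert (HD1 : Cmod (1 - w z) <= 1 + s).
  { unfold Cminus. eapply Rle_trans; [apply Cmod_triangle|].
    rewrite Cmod_1, Cmod_opp. unfold s. lra. }
  assert (HQ : 0 <= Q).
  { apply Rmult_le_reg_r with (Cmod (1 - w z) ^ 2); [apply pow_lt; auto|].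
    rewrite Hid, Rmult_0_l. apply Rmult_le_pos; [auto|]. simpl; nra. }
  assert (HQs : A * (1 - s) <= Q * (1 + s)).
  { apply Rmult_le_reg_r with (1 + s); [lra|].
    replace (A * (1 - s) * (1 + s)) with (A * (1 - s ^ 2)) by ring.
    rewrite <- Hid, Rmult_assoc. apply Rmult_le_compat_l; [auto|].
    simpl. nra. }
  nra.
Qed.

(** Real and imaginary parts are treated at once, as real-linear functionals bounded by the
    modulus. *)
Lemma first_order_ray (f : C -> C) (u l : C) (t : R) :
  Cmod u = 1 -> first_order_at f (RtoC t * u)%C l ->
  is_derive (fun s => Re (f (RtoC s * u)%C)) t (Re (u * l)) /\
  is_derive (fun s => Im (f (RtoC s * u)%C)) t (Im (u * l)).
Proof.
  intros Hu [K [d [HK [Hd H]]]].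
  assert (Hgen : forall P : C -> R, (forall c, Rabs (P c) <= Cmod c) ->
    (forall x y, P (x - y)%C = P x - P y) -> (forall (r : R) c, P (RtoC r * c)%C = r * P c) ->
    is_derive (fun s => P (f (RtoC s * u)%C)) t (P (u * l)%C)).
  { intros P Hle Hminus Hscal. apply is_derive_Reals. intros eps Heps.
    assert (Hm : 0 < Rmin d (eps / (K + 1))).
    { apply Rmin_glb_lt; [auto|]. apply Rdiv_lt_0_compat; lra. }
    exists (mkposreal _ Hm). simpl. intros h Hh0 Hh.
    assert (Hh1 : Rabs h < d) by (eapply Rlt_le_trans; [exact Hh|apply Rmin_l]).
    assert (Hh2 : Rabs h < eps / (K + 1)) by (eapply Rlt_le_trans; [exact Hh|apply Rmin_r]).
    assert (Hhu : Cmod (RtoC h * u) = Rabs h) by (rewrite Cmod_mult, Cmod_R, Hu; ring).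
    specialize (H (RtoC h * u)%C ltac:(lra)). rewrite Hhu in H.
    replace (RtoC t * u + RtoC h * u)%C with (RtoC (t + h) * u)%C in H
      by (rewrite RtoC_plus; ring).
    assert (HP := Rle_trans _ _ _ (Hle _) H).
    rewrite !Hminus in HP.
    replace (RtoC h * u * l)%C with (RtoC h * (u * l))%C in HP by ring.
    rewrite Hscal in HP.
    assert (Hpos : 0 < Rabs h) by now apply Rabs_pos_lt.
    apply Rmult_lt_reg_r with (Rabs h); [auto|].
    rewrite <- Rabs_mult.
    match goal with |- Rabs ?x < _ =>
      replace x with (P (f (RtoC (t + h) * u)%C) - P (f (RtoC t * u)%C) - h * P (u * l)%C)
        by (field; auto) end.
    eapply Rle_lt_trans; [exact HP|].
    apply (Rmult_lt_compat_l (K + 1)) in Hh2; [|lra].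
    replace ((K + 1) * (eps / (K + 1))) with eps in Hh2 by (field; lra).
    simpl. nra. }
  split; apply Hgen.
  - apply re_le_Cmod.
  - intros [x1 x2] [y1 y2]. reflexivity.
  - intros; apply re_scal_l.
  - apply im_le_Cmod.
  - intros [x1 x2] [y1 y2]. reflexivity.
  - intros; apply im_scal_l.
Qed.

(* [|f (t u)|^2 (1 + t)^4 / t^2] is nondecreasing in [t] and tends to [1] at 0. *)
Lemma starlike_growth_lower (f : C -> C) (a : nat -> C) (z : C) :
  starlike f a -> disk z -> Cmod z <= Cmod (f z) * (1 + Cmod z) ^ 2.
Proof.
  intros Hs Hz.
  destruct (Req_dec (Cmod z) 0) as [Hz0|Hz0].
  { rewrite Hz0. apply Rmult_le_pos; [apply Cmod_ge_0|apply pow2_ge_0]. }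
  set (r := Cmod z) in *.
  assert (Hr : 0 < r) by (assert (H := Cmod_ge_0 z); unfold r in *; lra).
  assert (Hr1 : r < 1) by exact Hz.
  set (u := (z / RtoC r)%C).
  assert (HrC : RtoC r <> RtoC 0) by (intros H; apply RtoC_inj in H; lra).
  assert (Hu : Cmod u = 1).
  { unfold u. rewrite Cmod_div, Cmod_R, Rabs_right by (auto; lra). fold r. field. lra. }
  assert (Ez : (RtoC r * u)%C = z) by (unfold u; field; auto).
  assert (Hmod : forall t, 0 <= t -> Cmod (RtoC t * u) = t).
  { intros t Ht. rewrite Cmod_mult, Cmod_R, Hu, Rabs_right; lra. }
  destruct (expansion_C_derive f a (proj1 Hs)) as [Hder Hfo].
  set (X := fun t => Re (f (RtoC t * u)%C)).
  set (Y := fun t => Im (f (RtoC t * u)%C)).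
  set (L := fun t => (u * C_derive f (RtoC t * u)%C)%C).
  (* With the square, neither a logarithm nor a square root has to be differentiated. In [dphi] the
     derivative is factored so that its bracket is nonnegative by [starlike_Re_bound]. *)
  set (phi := fun t => (X t ^ 2 + Y t ^ 2) * (1 + t) ^ 4 / t ^ 2).
  set (dphi := fun t => (1 + t) ^ 3 / t ^ 3 *
     (2 * (1 + t) * (t * (X t * Re (L t) + Y t * Im (L t)))
      - 2 * (1 - t) * (X t ^ 2 + Y t ^ 2))).
  assert (Hphi : forall t, 0 < t < 1 -> is_derive phi t (dphi t)).
  { intros t Ht.
    assert (Hd : disk (RtoC t * u)) by (unfold disk; rewrite Hmod; lra).
    destruct (first_order_ray f u _ t Hu (Hfo _ Hd)) as [HX HY].
    change (is_derive X t (Re (L t))) in HX. change (is_derive Y t (Im (L t))) in HY.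
    unfold phi. auto_derive.
    - repeat split; try (eexists; eassumption). intros H; nra.
    - change (fun x => X x) with X. change (fun x => Y x) with Y.
      rewrite (is_derive_unique X t _ HX), (is_derive_unique Y t _ HY).
      unfold dphi. field. lra. }
  assert (Hdphi : forall t, 0 < t < 1 -> 0 <= dphi t).
  { intros t Ht.
    assert (Hd : disk (RtoC t * u)) by (unfold disk; rewrite Hmod; lra).
    assert (H := starlike_Re_bound f a _ Hs Hd). rewrite Hmod in H by lra.
    unfold dphi. apply Rmult_le_pos.
    - apply Rdiv_le_0_compat; [apply pow_le; lra|apply pow_lt; lra].
    - rewrite Cmod2_alt in H. fold (X t) (Y t) in H.
      replace (Re (RtoC t * u * C_derive f (RtoC t * u)%C * Cconj (f (RtoC t * u)%C)))
        with (t * (X t * Re (L t) + Y t * Im (L t))) in H; [lra|].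
      replace (RtoC t * u * C_derive f (RtoC t * u)%C * Cconj (f (RtoC t * u)%C))%C
        with (RtoC t * (L t * Cconj (f (RtoC t * u)%C)))%C by (unfold L; ring).
      rewrite re_scal_l, re_mult, re_conj, im_conj. fold (X t) (Y t). ring. }
  assert (Hmono : forall t, 0 < t < r -> phi t <= phi r).
  { intros t Ht.
    destruct (MVT_gen phi t r dphi) as [c [Hc E]].
    - intros x. rewrite Rmin_left, Rmax_right by lra. intros Hx. apply Hphi; lra.
    - intros x. rewrite Rmin_left, Rmax_right by lra. intros Hx.
      apply continuity_pt_filterlim, (ex_derive_continuous phi).
      exists (dphi x). apply Hphi; lra.
    - rewrite Rmin_left, Rmax_right in Hc by lra.
      assert (H := Hdphi c ltac:(lra)). nra. }
  assert (EX : forall t, X t ^ 2 + Y t ^ 2 = Cmod (f (RtoC t * u)%C) ^ 2).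
  { intros t. rewrite Cmod2_alt. reflexivity. }
  destruct (Hfo _ disk_0) as [K [d [HK [Hd H0]]]].
  assert (Ed : C_derive f (RtoC 0) = RtoC 1).
  { rewrite (expansion_0 _ _ Hder). unfold derived.
    destruct Hs as [_ [_ [H1 _]]]. rewrite H1. simpl. ring. }
  rewrite Ed, (starlike_0 f a Hs) in H0.
  assert (Hone : 1 <= phi r).
  { apply (le_of_small_error _ _ (2 * K)); [lra|]. intros t0 Ht0.
    destruct (small_witness t0 d (r / 2)) as [t [Ht [H1 [H2 H3]]]]; try lra.
    apply Rle_trans with (phi t + 2 * K * t).
    2:{ assert (H4 := Hmono t ltac:(lra)). nra. }
    specialize (H0 (RtoC t * u)%C). rewrite Hmod in H0 by lra. specialize (H0 H2).
    replace (RtoC 0 + RtoC t * u)%C with (RtoC t * u)%C in H0 by ring.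
    replace (f (RtoC t * u)%C - RtoC 0 - RtoC t * u * RtoC 1)%C
      with (f (RtoC t * u)%C - RtoC t * u)%C in H0 by ring.
    rewrite Cmod_minus_sym in H0.
    assert (H4 := Cmod_triangle_minus (RtoC t * u) (RtoC t * u - f (RtoC t * u)%C)).
    replace (RtoC t * u - (RtoC t * u - f (RtoC t * u)%C))%C with (f (RtoC t * u)%C) in H4 by ring.
    rewrite Hmod in H4 by lra.
    unfold phi. rewrite EX.
    set (F := Cmod (f (RtoC t * u)%C)) in *.
    assert (HF : 0 <= F) by apply Cmod_ge_0.
    assert (Hq : 1 - K * t <= F / t).
    { apply Rmult_le_reg_r with t; [lra|].
      replace (F / t * t) with F by (field; lra). simpl in H0. lra. }
    assert (Hq0 : 0 <= F / t) by (apply Rdiv_le_0_compat; lra).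
    replace (F ^ 2 * (1 + t) ^ 4 / t ^ 2) with ((F / t) ^ 2 * (1 + t) ^ 4) by (field; lra).
    assert (1 <= (1 + t) ^ 4) by (rewrite <- (pow1 4); apply pow_incr; lra).
    assert (Hsq : 0 <= (F / t) ^ 2) by apply pow2_ge_0.
    (* From x^2 >= 2 x - 1 at x = F / t, whatever the sign of 1 - K t. *)
    assert (Hsq2 : 1 - 2 * K * t <= (F / t) ^ 2).
    { assert (H6 : 0 <= (F / t - 1) ^ 2) by apply pow2_ge_0. nra. }
    nra. }
  unfold phi in Hone. rewrite EX, Ez in Hone.
  assert (HF : 0 <= Cmod (f z)) by apply Cmod_ge_0.
  assert (Hsq : r ^ 2 <= (Cmod (f z) * (1 + r) ^ 2) ^ 2).
  { apply (Rmult_le_compat_r (r ^ 2)) in Hone; [|apply pow2_ge_0].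
    replace (Cmod (f z) ^ 2 * (1 + r) ^ 4 / r ^ 2 * r ^ 2)
      with ((Cmod (f z) * (1 + r) ^ 2) ^ 2) in Hone by (field; lra).
    lra. }
  rewrite <- !Rsqr_pow2 in Hsq. apply Rsqr_incr_0_var in Hsq; [now rewrite Rsqr_pow2 in Hsq|].
  rewrite Rsqr_pow2.
  apply Rmult_le_pos; [auto|apply pow2_ge_0].
Qed.

Lemma starlike_quarter (f : C -> C) (a : nat -> C) (w : C) :
  starlike f a -> boundary (image_of_disk f) w -> 1 / 4 <= Cmod w.
Proof.
  intros Hs Hb. apply Rnot_lt_le. intros Hw.
  (* Budget: 1/4 - |w| = 8 eps. On the circle |f z| >= 1/4 - eps and |v| < |w| + eps, so |f z - v| >
     6 eps, whereas |f z1 - v| < 2 eps. *)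
  set (eps := (1 / 4 - Cmod w) / 8).
  assert (Hw0 := Cmod_ge_0 w).
  assert (Heps : 0 < eps < 1 / 16) by (unfold eps; lra).
  destruct (Hb eps (proj1 Heps)) as [[u [[z1 [Hz1 Eu]] Hu]] [v [Hv Hvw]]].
  apply Hv. unfold disk in Hz1.
  set (r := Rmax (Cmod z1) (1 - eps)).
  assert (Hr1 : Cmod z1 <= r) by apply Rmax_l.
  assert (Hr2 : 1 - eps <= r) by apply Rmax_r.
  assert (Hr : r < 1) by (apply Rmax_lub_lt; lra).
  destruct (value_attained f r v z1) as [z [Hz Ez]]; auto.
  - intros z Hz. assert (Hd : disk z) by (unfold disk; lra).
    exists (C_derive f z). split; [now apply (starlike_derive_neq_0 f a)|].
    now apply (proj2 (expansion_C_derive f a (proj1 Hs))).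
  - intros z Hz. assert (Hd : disk z) by (unfold disk; lra).
    assert (Hg := starlike_growth_lower f a z Hs Hd). rewrite Hz in Hg.
    assert (Hg2 : 1 / 4 - eps <= Cmod (f z)).
    (* [Hkey] amounts to (1-r)^2 / 4 <= eps (1+r)^2, which holds because 1 - r <= eps < 1. *)
    { assert (Hfz := Cmod_ge_0 (f z)).
      assert (Hkey : (1 / 4 - eps) * (1 + r) ^ 2 <= r) by (simpl; nra).
      apply Rmult_le_reg_r with ((1 + r) ^ 2); [apply pow_lt; lra|lra]. }
    assert (H1 := Cmod_triangle_minus (f z) v).
    assert (H2 := Cmod_triangle_minus v w).
    assert (H3 := Cmod_triangle (f z1 - w) (w - v)).
    replace (f z1 - w + (w - v))%C with (f z1 - v)%C in H3 by ring.
    rewrite (Cmod_minus_sym w v) in H3. rewrite Eu in Hu.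
    unfold eps in *. lra.
  - exists z. split; [unfold disk; lra|auto].
Qed.

Lemma starlike_distance (f : C -> C) (a : nat -> C) (x : R) :
  starlike f a -> x <= 1 / 4 ->
  Rbar_le (Finite x) (distance (RtoC 0) (boundary (image_of_disk f))).
Proof.
  intros Hs Hx. unfold distance.
  apply (proj2 (Glb_Rbar_correct _)). intros d [u [Hu ->]].
  assert (H := starlike_quarter f a u Hs Hu).
  replace (RtoC 0 - u)%C with (- u)%C by ring. rewrite Cmod_opp. simpl. lra.
Qed.

(** * The Koebe function and the radius equation *)

Lemma INR_temperate : temperate INR.
Proof.
  apply (temperate_le INR (fun n => INR n * 1)).
  - intros n. rewrite Rmult_1_r. split; [apply pos_INR|lra].
  - apply temperate_INR, temperate_1.
Qed.

Lemma INR_pow_lim_0 (r : R) : 0 <= r < 1 -> is_lim_seq (fun n => INR n * r ^ n) 0.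
Proof. intros Hr. apply ex_series_lim_0, temperate_series; [apply INR_temperate|auto]. Qed.

Definition koebe (z : C) : C := (z / ((1 - z) * (1 - z)))%C.

Lemma koebe_expansion : has_expansion koebe (fun n => RtoC (INR n)).
Proof.
  intros z Hz. apply is_pseries_C_iff, is_series_C_iff. intros eps Heps.
  assert (Hp := disk_1_minus z Hz).
  assert (Hp' : 0 < Cmod (1 - z)) by now apply Cmod_gt_0.
  assert (Hz0 := Cmod_ge_0 z). unfold disk in Hz.
  assert (Hp2 : Cmod (1 - z) <= 2).
  { unfold Cminus. eapply Rle_trans; [apply Cmod_triangle|].
    rewrite Cmod_1, Cmod_opp. lra. }
  (* A closed form of the remainder, of size at most 3 n |z|^n / |1-z|^2 for n >= 1; hence the
     threshold eps q / 4 below and the start at [S n0]. *)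
  assert (E : forall n, (csum (fun k => RtoC (INR k) * z ^ k) n - koebe z
     = - (z ^ n * (RtoC (INR n) * (1 - z) + z) / ((1 - z) * (1 - z))))%C).
  { unfold koebe. induction n as [|n IH]; [simpl; field; auto|].
    cbn [csum]. rewrite S_INR, RtoC_plus, Cpow_S.
    replace (csum (fun k => RtoC (INR k) * z ^ k) n + RtoC (INR n) * z ^ n
             - z / ((1 - z) * (1 - z)))%C
      with (csum (fun k => RtoC (INR k) * z ^ k) n - z / ((1 - z) * (1 - z))
            + RtoC (INR n) * z ^ n)%C by ring.
    rewrite IH. field. auto. }
  set (q := Cmod (1 - z) ^ 2). assert (Hq : 0 < q) by (apply pow_lt; auto).
  assert (Hlim := INR_pow_lim_0 (Cmod z) (conj Hz0 Hz)). apply is_lim_seq_spec in Hlim.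
  assert (Heps' : 0 < eps * q / 4) by (apply Rdiv_lt_0_compat; [apply Rmult_lt_0_compat|]; lra).
  destruct (Hlim (mkposreal _ Heps')) as [n0 Hn0]. simpl in Hn0.
  exists (S n0). intros n Hn. rewrite E, Cmod_opp.
  rewrite Cmod_div by (apply Cmult_neq_0; auto).
  rewrite !Cmod_mult, Cmod_pow.
  replace (Cmod (1 - z) * Cmod (1 - z)) with q by (unfold q; ring).
  specialize (Hn0 n ltac:(lia)). rewrite Rminus_0_r in Hn0. apply Rabs_def2 in Hn0.
  assert (Hn1 : 1 <= INR n) by (apply (le_INR 1); lia).
  assert (Ht : Cmod (RtoC (INR n) * (1 - z) + z) <= 3 * INR n).
  { eapply Rle_trans; [apply Cmod_triangle|].
    rewrite Cmod_mult, Cmod_R, Rabs_right by lra. nra. }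
  apply Rmult_lt_reg_r with q; [auto|].
  replace (Cmod z ^ n * Cmod (RtoC (INR n) * (1 - z) + z) / q * q)
    with (Cmod z ^ n * Cmod (RtoC (INR n) * (1 - z) + z)) by (field; lra).
  assert (0 <= Cmod z ^ n) by (apply pow_le; auto).
  nra.
Qed.

(** Over the common denominator the difference of two values has numerator (z - w)(1 - z w), and |z
    w| < 1. *)
Lemma koebe_univalent : univalent koebe.
Proof.
  intros z w Hz Hw H. unfold koebe in H.
  assert (Hp := disk_1_minus z Hz). assert (Hq := disk_1_minus w Hw).
  assert (E : ((z - w) * (1 - z * w))%C = RtoC 0).
  { transitivity ((z / ((1 - z) * (1 - z)) - w / ((1 - w) * (1 - w)))
                  * ((1 - z) * (1 - z) * ((1 - w) * (1 - w))))%C.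
    - field. auto.
    - rewrite H. ring. }
  apply Ceq_minus.
  destruct (Ceq_dec (z - w) (RtoC 0)) as [|Hne]; auto. exfalso.
  apply (Cmult_neq_0 _ _ Hne) in E; auto.
  apply disk_1_minus. unfold disk in *. rewrite Cmod_mult.
  assert (H1 := Cmod_ge_0 z). assert (H2 := Cmod_ge_0 w). nra.
Qed.

Lemma koebe_derive (z : C) :
  disk z -> C_derive koebe z = ((1 + z) / ((1 - z) * (1 - z) * (1 - z)))%C.
Proof.
  intros Hz. apply is_C_derive_unique, first_order_is_derive.
  assert (Hz0 := Cmod_ge_0 z). unfold disk in Hz.
  set (d := (1 - Cmod z) / 2). assert (Hd : 0 < d) by (unfold d; lra).
  (* With p = 1 - z and q = 1 - z - h the remainder is exactly h^2 (p + 2q - pq) / (p^3 q^2). Both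
     moduli lie between d and 2, so the numerator factor is at most 2 + 4 + 4 and the denominator at
     least d^5. *)
  exists (10 / d ^ 5), d. split; [|split; [auto|]].
  { apply Rdiv_le_0_compat; [lra|apply pow_lt; auto]. }
  intros h Hh.
  set (p := (1 - z)%C). set (q := (1 - (z + h))%C).
  assert (Hlow : forall y, Cmod y <= Cmod z + d -> d <= Cmod (1 - y) <= 2).
  { intros y Hy. assert (H1 := Cmod_triangle_minus 1 y).
    rewrite Cmod_1 in H1. split; [unfold d in *; lra|].
    unfold Cminus. eapply Rle_trans; [apply Cmod_triangle|].
    rewrite Cmod_1, Cmod_opp. unfold d in *; lra. }
  assert (Hp : d <= Cmod p <= 2) by (apply Hlow; lra).
  assert (Hq : d <= Cmod q <= 2).
  { apply Hlow. eapply Rle_trans; [apply Cmod_triangle|]. lra. }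
  assert (Hp0 : p <> RtoC 0) by (apply Cmod_gt_0; lra).
  assert (Hq0 : q <> RtoC 0) by (apply Cmod_gt_0; lra).
  assert (E : (koebe (z + h)%C - koebe z - h * ((1 + z) / (p * p * p))
              = h * h * (p + 2 * q - p * q) / (p * p * p * (q * q)))%C).
  { unfold koebe. fold p q.
    replace h with (p - q)%C by (unfold p, q; ring).
    replace z with (1 - p)%C by (unfold p; ring). field. auto. }
  rewrite E, Cmod_div by (repeat apply Cmult_neq_0; auto).
  rewrite !Cmod_mult.
  assert (Hnum : Cmod (p + 2 * q - p * q) <= 10).
  { unfold Cminus. eapply Rle_trans; [apply Cmod_triangle|].
    rewrite Cmod_opp, Cmod_mult.
    assert (H1 := Cmod_triangle p (2 * q)).
    rewrite Cmod_mult, Cmod_R, Rabs_right in H1 by lra. nra. }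
  assert (Hden : d ^ 5 <= Cmod p * Cmod p * Cmod p * (Cmod q * Cmod q)).
  { replace (d ^ 5) with (d * d * d * (d * d)) by ring.
    repeat apply Rmult_le_compat; try lra; repeat apply Rmult_le_pos; lra. }
  assert (Hd5 : 0 < d ^ 5) by (apply pow_lt; auto).
  assert (H1 := Cmod_ge_0 (p + 2 * q - p * q)).
  replace (10 / d ^ 5 * Cmod h ^ 2) with (Cmod h * Cmod h * 10 * / d ^ 5)
    by (field; lra).
  unfold Rdiv. assert (H2 := Cmod_ge_0 h).
  apply Rmult_le_compat.
  - repeat apply Rmult_le_pos; auto.
  - left. apply Rinv_0_lt_compat. lra.
  - apply Rmult_le_compat_l; [apply Rmult_le_pos; auto|auto].
  - apply Rinv_le_contravar; auto.
Qed.

Lemma koebe_starlike : starlike koebe (fun n => RtoC (INR n)).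
Proof.
  split; [apply koebe_expansion|]. split; [reflexivity|]. split; [reflexivity|].
  split; [apply koebe_univalent|].
  (* For the Koebe function z f'/f is exactly (1+z)/(1-z), so the Schwarz function is the identity;
     its expansion is obtained as the constant 1 times the polynomial z. *)
  exists (fun z => z). split; [|split; [reflexivity|split; [auto|]]].
  - destruct (analytic_mult_poly (fun _ => RtoC 1) (fun k => match k with 1%nat => RtoC 1 | _ => RtoC 0 end) 2)
      as [b Hb].
    + exists (fun n => match n with O => RtoC 1 | _ => RtoC 0 end).
      intros z Hz. apply is_pseries_C_iff, is_series_C_iff. intros eps Heps.
      exists 1%nat. intros [|n] Hn; [lia|].
      replace (csum _ (S n)) with (RtoC 1).
      * replace (1 - 1)%C with (RtoC 0) by ring. now rewrite Cmod_0.
      * clear. induction n as [|n IH]; [simpl; ring|].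
        cbn [csum] in *. rewrite <- IH. ring.
    + exists b. eapply expansion_ext; [|reflexivity|exact Hb].
      intros z _. simpl. ring.
  - intros z Hz. unfold starlike_quotient.
    destruct (Ceq_dec z (RtoC 0)) as [->|Hz0].
    + field.
    + rewrite koebe_derive by auto. unfold koebe.
      assert (Hp := disk_1_minus z Hz). field. auto.
Qed.

(** The identity 4 (1-z)^2 (k(z) + 1/4) = (1+z)^2, whose right side vanishes only at -1. *)
Lemma koebe_omits (z : C) : disk z -> koebe z <> RtoC (- (1 / 4)).
Proof.
  intros Hz H. unfold koebe in H. assert (Hp := disk_1_minus z Hz).
  apply (Cmult_neq_0 (1 + z) (1 + z)); try now apply disk_1_plus.
  transitivity (4 * ((1 - z) * (1 - z)) * (z / ((1 - z) * (1 - z)) - RtoC (- (1 / 4))))%C.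
  - rewrite RtoC_opp, RtoC_div by lra. field. auto.
  - rewrite H. ring.
Qed.

Lemma koebe_real (t : R) : t < 1 -> koebe (RtoC t) = RtoC (t / (1 - t) ^ 2).
Proof.
  intros Ht. unfold koebe. rewrite RtoC_div by (apply pow_nonzero; lra).
  f_equal. rewrite <- RtoC_minus, <- RtoC_mult. f_equal. ring.
Qed.

Lemma koebe_boundary : boundary (image_of_disk koebe) (RtoC (- (1 / 4))).
Proof.
  intros eps Heps. split.
  (* The value -1/4 is approached along the negative radius, at -x with x near 1, where k(-x) + 1/4
     = (1-x)^2 / (4 (1+x)^2). *)
  - set (x := Rmax 0 (1 - eps / 2)).
    assert (Hx0 : 0 <= x) by apply Rmax_l.
    assert (Hx1 : 1 - eps / 2 <= x) by apply Rmax_r.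
    assert (Hx : x < 1) by (apply Rmax_lub_lt; lra).
    exists (koebe (RtoC (- x))). split.
    + exists (RtoC (- x)). split; [|reflexivity].
      unfold disk. rewrite Cmod_R, Rabs_Ropp, Rabs_right; lra.
    + rewrite koebe_real by lra. rewrite <- RtoC_minus, Cmod_R.
      replace (- x / (1 - - x) ^ 2 - - (1 / 4)) with ((1 - x) ^ 2 / (4 * (1 + x) ^ 2))
        by (field; lra).
      assert (Hsq : 1 <= (1 + x) ^ 2) by (simpl; nra).
      rewrite Rabs_right.
      * apply Rmult_lt_reg_r with (4 * (1 + x) ^ 2); [lra|].
        replace ((1 - x) ^ 2 / (4 * (1 + x) ^ 2) * (4 * (1 + x) ^ 2)) with ((1 - x) ^ 2)
          by (field; lra).
        simpl in *. nra.
      * apply Rle_ge, Rdiv_le_0_compat; [apply pow2_ge_0|lra].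
  - exists (RtoC (- (1 / 4))). split.
    + intros [z [Hz E]]. now apply (koebe_omits z Hz).
    + replace (RtoC (- (1 / 4)) - RtoC (- (1 / 4)))%C with (RtoC 0) by ring.
      now rewrite Cmod_0.
Qed.

Lemma koebe_distance :
  Rbar_le (distance (RtoC 0) (boundary (image_of_disk koebe))) (Finite (1 / 4)).
Proof.
  unfold distance. apply (proj1 (Glb_Rbar_correct _)).
  exists (RtoC (- (1 / 4))). split; [apply koebe_boundary|].
  rewrite <- RtoC_minus, Cmod_R, Rabs_right; lra.
Qed.

(** Telescoping: the closed form T satisfies T n - T (n+1) = n r^n and tends to 0. *)
Lemma linear_geometric_tail (N : nat) (r : R) :
  0 <= r < 1 ->
  Series (fun k => INR (N + k) * r ^ (N + k)) = r ^ N * (INR N * (1 - r) + r) / (1 - r) ^ 2.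
Proof.
  intros Hr. set (T := fun n => r ^ n * (INR n * (1 - r) + r) / (1 - r) ^ 2).
  apply is_series_unique.
  assert (Hlim : is_lim_seq T 0).
  { apply is_lim_seq_ext with (fun n => / (1 - r) * (INR n * r ^ n) + r / (1 - r) ^ 2 * r ^ n).
    - intros n. unfold T. field. lra.
    - replace (Finite 0) with (Finite (/ (1 - r) * 0 + r / (1 - r) ^ 2 * 0))
        by (f_equal; ring).
      apply is_lim_seq_plus'.
      + apply (is_lim_seq_scal_l _ (/ (1 - r)) 0). now apply INR_pow_lim_0.
      + apply (is_lim_seq_scal_l _ (r / (1 - r) ^ 2) 0).
        apply is_lim_seq_geom. rewrite Rabs_right; lra. }
  change (is_lim_seq (sum_n (fun k => INR (N + k) * r ^ (N + k))) (T N)).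
  apply is_lim_seq_ext with (fun n => T N - T (N + S n)%nat).
  - intros n. rewrite rsum_sum_n. generalize (S n). clear n. intros n.
    induction n as [|n IH]; [simpl; rewrite Nat.add_0_r; ring|].
    cbn [rsum]. rewrite <- IH. unfold T.
    rewrite Nat.add_succ_r, S_INR. simpl. field. lra.
  - replace (Finite (T N)) with (Finite (T N - 0)) by (f_equal; ring).
    apply is_lim_seq_minus'; [apply is_lim_seq_const|].
    apply is_lim_seq_ext with (fun n => T (n + S N)%nat).
    + intros n. f_equal. lia.
    + apply is_lim_seq_incr_n. exact Hlim.
Qed.

(** The coefficient bound is summed term by term, using the tail formula at N = 0. *)
Lemma starlike_growth_upper (f : C -> C) (a : nat -> C) (z : C) :
  starlike f a -> disk z -> Cmod (f z) <= Cmod z / (1 - Cmod z) ^ 2.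
Proof.
  intros Hs Hz. assert (Hz0 := Cmod_ge_0 z).
  assert (H := expansion_tail_bound f a z 0 (proj1 Hs) Hz).
  simpl csum in H. replace (f z - RtoC 0)%C with (f z) in H by ring.
  eapply Rle_trans; [exact H|].
  replace (Cmod z / (1 - Cmod z) ^ 2)
    with (Series (fun k => INR (0 + k) * Cmod z ^ (0 + k))).
  - apply Series_le.
    + intros k. split.
      * apply Rmult_le_pos; [apply Cmod_ge_0|apply pow_le; auto].
      * apply Rmult_le_compat_r; [apply pow_le; auto|].
        now apply (starlike_coef_bound f a).
    + apply temperate_series; [apply INR_temperate|auto].
  - rewrite linear_geometric_tail by auto. unfold disk in Hz. simpl. field. lra.
Qed.

(** The left side of the Bohr inequality for the Koebe function at z = r: the value k(r^m) plus the
    closed form of the tail of n r^n from N on. *)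
Definition bohr_majorant (m N : nat) (r : R) : R :=
  r ^ m / (1 - r ^ m) ^ 2 + r ^ N * (INR N * (1 - r) + r) / (1 - r) ^ 2.

Lemma pow_lt_1 (r : R) (m : nat) : (1 <= m)%nat -> 0 <= r < 1 -> 0 <= r ^ m < 1.
Proof.
  intros Hm Hr. split; [apply pow_le; lra|].
  eapply Rle_lt_trans; [apply (pow_antitone r 1 m); [lra|auto]|]. simpl. lra.
Qed.

Lemma radius_equation_majorant (m N : nat) (r : R) :
  (1 <= m)%nat -> 0 <= r < 1 ->
  radius_equation_lhs m N r = 4 * (1 - r ^ m) ^ 2 * (bohr_majorant m N r - 1 / 4).
Proof.
  intros Hm Hr. assert (H := pow_lt_1 r m Hm Hr).
  unfold radius_equation_lhs, bohr_majorant. field. lra.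
Qed.

Lemma pow_strict_mono (s t : R) (m : nat) : (1 <= m)%nat -> 0 <= s < t -> s ^ m < t ^ m.
Proof.
  intros Hm Hst. induction Hm as [|m _ IH]; [simpl; lra|].
  simpl. assert (0 <= s ^ m) by (apply pow_le; lra). nra.
Qed.

(** Strictness comes from the first summand, where y (1-x)^2 - x (1-y)^2 = (y-x)(1-xy) is positive;
    the second is a series compared term by term. *)
Lemma bohr_majorant_mono (m N : nat) (s t : R) :
  (1 <= m)%nat -> 0 <= s < t -> t < 1 -> bohr_majorant m N s < bohr_majorant m N t.
Proof.
  intros Hm Hst Ht. unfold bohr_majorant. apply Rplus_lt_le_compat.
  - assert (H1 := pow_strict_mono s t m Hm Hst).
    assert (H2 := pow_lt_1 s m Hm ltac:(lra)). assert (H3 := pow_lt_1 t m Hm ltac:(lra)).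
    set (x := s ^ m) in *. set (y := t ^ m) in *.
    assert (Hx : 0 < (1 - x) ^ 2) by (apply pow_lt; lra).
    assert (Hy : 0 < (1 - y) ^ 2) by (apply pow_lt; lra).
    apply Rmult_lt_reg_r with ((1 - x) ^ 2 * (1 - y) ^ 2); [now apply Rmult_lt_0_compat|].
    replace (x / (1 - x) ^ 2 * ((1 - x) ^ 2 * (1 - y) ^ 2)) with (x * (1 - y) ^ 2)
      by (field; lra).
    replace (y / (1 - y) ^ 2 * ((1 - x) ^ 2 * (1 - y) ^ 2)) with (y * (1 - x) ^ 2)
      by (field; lra).
    assert (0 < (y - x) * (1 - x * y)) by (apply Rmult_lt_0_compat; nra).
    simpl. lra.
  - rewrite <- !linear_geometric_tail by lra. apply Series_le.
    + intros k. assert (H := pos_INR (N + k)). split.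
      * apply Rmult_le_pos; [auto|apply pow_le; lra].
      * apply Rmult_le_compat_l; [auto|apply pow_incr; lra].
    + apply (ex_series_incr_n (fun k => INR k * t ^ k)).
      apply temperate_series; [apply INR_temperate|lra].
Qed.

Lemma bohr_majorant_root (m N : nat) :
  (1 <= m)%nat -> (1 <= N)%nat -> exists r, 0 < r < 1 /\ bohr_majorant m N r = 1 / 4.
Proof.
  intros Hm HN.
  assert (Hm1 : 1 <= INR m) by (apply (le_INR 1); auto).
  (* Bernoulli gives b^m >= 1/2, so the first summand alone is at least (1/2) / (1/2)^2 = 2 >
     1/4. *)
  set (b := 1 - / (2 * INR m)).
  assert (Hinv : 0 < / (2 * INR m) <= / 2).
  { split; [apply Rinv_0_lt_compat; lra|apply Rinv_le_contravar; lra]. }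
  assert (Hb : 0 < b < 1) by (unfold b; lra).
  assert (Hbm : 1 / 2 <= b ^ m).
  { eapply Rle_trans; [|apply Bernoulli_le; lra].
    right. field. lra. }
  assert (H0 : bohr_majorant m N 0 = 0).
  { unfold bohr_majorant. rewrite !pow_i by lia. field. }
  assert (Hb4 : 1 / 4 < bohr_majorant m N b).
  { unfold bohr_majorant. assert (H := pow_lt_1 b m Hm ltac:(lra)).
    assert (Hsq : 0 < (1 - b ^ m) ^ 2) by (apply pow_lt; lra).
    assert (H1 : 1 / 4 < b ^ m / (1 - b ^ m) ^ 2).
    { apply Rmult_lt_reg_r with ((1 - b ^ m) ^ 2); [auto|].
      replace (b ^ m / (1 - b ^ m) ^ 2 * (1 - b ^ m) ^ 2) with (b ^ m) by (field; lra).
      simpl. nra. }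
    assert (0 <= b ^ N * (INR N * (1 - b) + b) / (1 - b) ^ 2).
    { apply Rdiv_le_0_compat; [|apply pow_lt; lra].
      apply Rmult_le_pos; [apply pow_le; lra|].
      assert (H2 := pos_INR N). nra. }
    lra. }
  destruct (IVT_interv (fun r => bohr_majorant m N r - 1 / 4) 0 b) as [r [Hr E]].
  - intros x Hx. assert (H := pow_lt_1 x m Hm ltac:(lra)).
    apply continuity_pt_filterlim,
      (ex_derive_continuous (fun r => bohr_majorant m N r - 1 / 4)).
    unfold bohr_majorant. auto_derive. split; [|split; [|auto]]; intros Hc; nra.
  - lra.
  - rewrite H0. lra.
  - lra.
  - exists r. split; [|lra].
    split; [|lra]. destruct (Req_dec r 0) as [->|]; [|lra]. rewrite H0 in E. lra.
Qed.

Theorem corollary2p11 (m N : nat) (hm : (1 <= m)%nat) (hN : (1 <= N)%nat) :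
  exists r0 : R,
    smallest_positive_root (radius_equation_lhs m N) r0 /\
    bohr_inequality_upto m N r0 /\
    (forall rho : R, r0 < rho -> ~ bohr_inequality_upto m N rho).
Proof.
  destruct (bohr_majorant_root m N hm hN) as [r0 [Hr0 E0]].
  exists r0. split; [|split].
  - split; [lra|]. split.
    + rewrite radius_equation_majorant by (auto; lra). rewrite E0. ring.
    (* A competitor s < r0 lies in (0, 1), where the factorisation holds: its first factor is
       positive and the second negative. *)
    + intros s Hs Es. apply Rnot_lt_le. intros Hlt.
      rewrite radius_equation_majorant in Es by (auto; lra).
      assert (H := bohr_majorant_mono m N s r0 hm ltac:(lra) ltac:(lra)).
      assert (Hs1 := pow_lt_1 s m hm ltac:(lra)).
      assert (0 < (1 - s ^ m) ^ 2) by (apply pow_lt; lra).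
      nra.
  - intros f a Hs z Hz Hzr. unfold bohr_inequality.
    apply (starlike_distance f a); auto.
    set (r := Cmod z) in *. assert (Hr : 0 <= r) by apply Cmod_ge_0.
    rewrite <- E0.
    apply Rle_trans with (bohr_majorant m N r).
    + unfold bohr_majorant. apply Rplus_le_compat.
      * assert (Hzm : Cmod (z ^ m) = r ^ m) by apply Cmod_pow.
        rewrite <- Hzm. apply (starlike_growth_upper f a); auto.
        unfold disk. rewrite Hzm. apply (pow_lt_1 r m); auto.
      * rewrite <- linear_geometric_tail by auto. apply Series_le.
        -- intros k. split.
           ++ apply Rmult_le_pos; [apply Cmod_ge_0|apply pow_le; auto].
           ++ apply Rmult_le_compat_r; [apply pow_le; auto|].
              now apply (starlike_coef_bound f a).
        -- apply (ex_series_incr_n (fun k => INR k * r ^ k)).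
           apply temperate_series; [apply INR_temperate|auto].
    + destruct (Rle_lt_or_eq_dec _ _ Hzr) as [Hlt|Heq]; [|rewrite Heq; lra].
      left. apply bohr_majorant_mono; auto; lra.
  - intros rho Hrho H.
    (* [rho] may exceed 1, so the test point is kept inside the disk as well as below [rho], yet
       beyond [r0]. *)
    set (t := Rmin ((r0 + 1) / 2) rho).
    assert (Ht : r0 < t) by (apply Rmin_glb_lt; lra).
    assert (Ht1 : t <= (r0 + 1) / 2) by apply Rmin_l.
    assert (Ht2 : t <= rho) by apply Rmin_r.
    assert (Hz : Cmod (RtoC t) = t) by (rewrite Cmod_R, Rabs_right; lra).
    assert (Hb := H koebe _ koebe_starlike (RtoC t) ltac:(unfold disk; lra) ltac:(lra)).
    unfold bohr_inequality in Hb.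
    assert (Hle := Rbar_le_trans _ _ _ Hb koebe_distance). simpl in Hle.
    rewrite Hz, <- RtoC_pow in Hle.
    assert (Htm := pow_lt_1 t m hm ltac:(lra)).
    rewrite koebe_real, Cmod_R, Rabs_right in Hle;
      [|apply Rle_ge, Rdiv_le_0_compat; [lra|apply pow_lt; lra]|lra].
    rewrite (Series_ext _ (fun k => INR (N + k) * t ^ (N + k))) in Hle.
    2:{ intros k. rewrite Cmod_R, Rabs_right by (apply Rle_ge, pos_INR). reflexivity. }
    rewrite linear_geometric_tail in Hle by lra.
    change (bohr_majorant m N t <= 1 / 4) in Hle.
    assert (Hmono := bohr_majorant_mono m N r0 t hm ltac:(lra) ltac:(lra)). lra.
Qed.
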